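(* Let $n\ge 1$, let $\lambda=(\lambda_{n-1},\ldots,\lambda_1)$ be a partition with $\lambda_{n-1}\ge\cdots\ge\lambda_1\ge 0$ and $\lambda_k\le k$ for all $k$, and let $u_1,\ldots,u_{n-1}$ be complex parameters. Set $\lambda_0=u_0=0$, and for $0\le k\le n-1$ put $$a_k=\lambda_k+k+1,\qquad v_k=u_k+k-\lambda_k,\qquad y_k=-\frac{[v_k]}{[v_k+1]}.$$ Then $$ \begin{aligned} \mathrm{M}_{(\lambda_{n-1},\ldots,\lambda_1)}(u_1,\ldots,u_{n-1}) &=\Delta_t(z_1,\ldots,z_{2n})\oint\cdots\oint\frac{1}{(2\pi i)^n}\,\Delta(w_n,\ldots,w_1)\,\Delta_t(w_1,\ldots,w_n)\prod_{m=0}^{n-1}\bigl(1+y_mS_{a_m}\bigr)\phi_{a_m}(w_{m+1})\,dw_1\cdots dw_n\\ &=\Delta_t(z_1,\ldots,z_{2n})\oint\cdots\oint\frac{1}{(2\pi i)^n}\,\Delta(w_n,\ldots,w_1)\,\Delta_t(w_1,\ldots,w_n)\prod_{m=0}^{n-1}\frac{1}{[v_m+1]}\left(\frac{t^{v_m+1}w_{m+1}-t^{-v_m-1}z_{a_m}}{t\,w_{m+1}-t^{-1}z_{a_m}}\right)\phi_{a_m}(w_{m+1})\,dw_1\cdots dw_n . \end{aligned} $$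
   Context: Fix a nonzero complex number $t$, not a root of unity, with a fixed choice of logarithm so that $t^u$ makes sense for $u\in\mathbb{C}$; put $[u]=\frac{t^u-t^{-u}}{t-t^{-1}}$. Parameters are generic: every $t$-number occurring in a denominator is nonzero. Operators. On functions of $z_1,\ldots,z_{2n}$ let $s_i$ exchange $z_i$ and $z_{i+1}$, let $\nabla_i f=\frac{t z_i-t^{-1}z_{i+1}}{z_i-z_{i+1}}(f-s_if)$, and define $T_i=\nabla_i-t^{-1}$ and the Baxterised operator $T_i(u)=T_i+\frac{t^{-u}}{[u]}=\nabla_i-t^{-1}+\frac{t^{-u}}{[u]}$ for $[u]\ne0$. The $T_i$ satisfy the Hecke algebra relations. Notation. $\Delta_t(x_1,\ldots,x_N)=\prod_{1\le i<j\le N}(t x_i-t^{-1}x_j)$ and $\Delta(x_1,\ldots,x_N)=\prod_{1\le i<j\le N}(x_i-x_j)$, so $\Delta(w_n,\ldots,w_1)=\prod_{i<j}(w_j-w_i)$. Deformed Macdonald polynomials. Draw the diagram of $\lambda=(\lambda_{n-1},\ldots,\lambda_1)$ with row $i$ from the top ($1\le i\le n-1$) having $\lambda_{n-i}$ boxes, left-justified; box $(i,j)$ is in row $i$, column $j$. To box $(i,j)$ attach the operator $T_{n+j-i}(u_{n-i}+n-i-j+1)$. Then $\mathrm{M}_\lambda(u_1,\ldots,u_{n-1})$ is the polynomial in $z_1,\ldots,z_{2n}$ obtained by applying to $\Delta_t(z_1,\ldots,z_n)\Delta_t(z_{n+1},\ldots,z_{2n})$ the operators of all boxes of $\lambda$,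 the operator of a box acting before those of the boxes to its right in the same row and below it in the same column (e.g. row by row from the top, each row from left to right; all admissible orders give the same result). E.g. for $n=3$, $\mathrm{M}_{(2,1)}(u_1,u_2)=T_2(u_1+1)T_4(u_2+1)T_3(u_2+2)\,\Delta_t(z_1,z_2,z_3)\Delta_t(z_4,z_5,z_6)$. Wave functions. For $0\le i\le 2n$, $\phi_i(w)=\prod_{m=1}^i\frac{1}{w-z_m}\prod_{m=i+1}^{2n}\frac{1}{t w-t^{-1}z_m}$. The shift operator $S_i$ acts by $S_i\phi_i=\phi_{i-1}$ and $S_i\phi_j=\phi_j$ for $j\ne i$; thus $(1+y_mS_{a_m})\phi_{a_m}(w)=\phi_{a_m}(w)+y_m\phi_{a_m-1}(w)$. Contours. For generic $z_1,\dots,z_{2n}$, each integration contour encircles (once, counterclockwise) all points $z_1,\ldots,z_{2n}$ but none of the points $t^{-2}z_1,\ldots,t^{-2}z_{2n}$. *)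

(* Defs.v *)
(* Concrete complex numbers and Riemann integrals are those of Coquelicot;
   naturals, sequences and iterated products are those of MathComp. *)
From Stdlib Require Import Reals.
From Coquelicot Require Import Coquelicot.
From mathcomp Require Import ssreflect ssrfun ssrbool eqtype ssrnat seq bigop.

Set Implicit Arguments.
Unset Strict Implicit.
Unset Printing Implicit Defensive.

Local Open Scope C_scope.

(* Families (z_1, ..., z_N) are functions nat -> C read at the indices 1..N
   only; values at other indices are irrelevant. *)

Definition NtoC (k : nat) : C := RtoC (INR k).

Definition Cexp (x : C) : C :=
  ((exp (Re x) * cos (Im x))%R, (exp (Re x) * sin (Im x))%R).

(* t^x for the branch given by a logarithm logt of t. *)
Definition tpow (logt x : C) : C := Cexp (logt * x).

Definition tnum (t logt x : C) : C :=
  (tpow logt x - tpow logt (- x)) / (t - / t).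

Definition Delta_t (t : C) (N : nat) (x : nat -> C) : C :=
  \big[Cmult/RtoC 1]_(1 <= j < N.+1)
    \big[Cmult/RtoC 1]_(1 <= i < j) (t * x i - / t * x j).

(* Undeformed counterpart of Delta_t. *)
Definition vdm (N : nat) (x : nat -> C) : C :=
  \big[Cmult/RtoC 1]_(1 <= j < N.+1)
    \big[Cmult/RtoC 1]_(1 <= i < j) (x i - x j).

Definition swap (i : nat) (z : nat -> C) : nat -> C :=
  fun k => if k == i then z i.+1 else if k == i.+1 then z i else z k.

(* The operators act on functions of z.  As division is total, the value of
   nabla i f at a point with z i = z i.+1 is meaningless; iterates are
   meaningful at points with pairwise distinct coordinates. *)
Definition nabla (t : C) (i : nat) (f : (nat -> C) -> C) : (nat -> C) -> C :=
  fun z => (t * z i - / t * z i.+1) / (z i - z i.+1) * (f z - f (swap i z)).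

Definition Tbax (t logt : C) (i : nat) (x : C) (f : (nat -> C) -> C) :
    (nat -> C) -> C :=
  fun z => nabla t i f z - / t * f z + tpow logt (- x) / tnum t logt x * f z.

(* Row i of the diagram, 1 <= i <= n - 1, has lam (n - i) boxes.  The boxes are
   listed row by row from the top, each row from left to right. *)
Definition boxes (n : nat) (lam : nat -> nat) : seq (nat * nat) :=
  [seq (i, j) | i <- iota 1 n.-1, j <- iota 1 (lam (n - i)%N)].

Definition boxpar (n : nat) (u : nat -> C) (b : nat * nat) : C :=
  u (n - b.1)%N + NtoC n - NtoC b.1 - NtoC b.2 + 1.

(* foldl: the operator of the first box of the list acts first. *)
Definition Mac (t logt : C) (n : nat) (lam : nat -> nat) (u : nat -> C) :
    (nat -> C) -> C :=
  foldl (fun f b => Tbax t logt (n + b.2 - b.1)%N (boxpar n u b) f)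
    (fun z => Delta_t t n z * Delta_t t n (fun i => z (n + i)%N))
    (boxes n lam).

Definition phi (t : C) (n : nat) (z : nat -> C) (i : nat) (w : C) : C :=
  \big[Cmult/RtoC 1]_(1 <= m < i.+1) / (w - z m)
  * \big[Cmult/RtoC 1]_(i.+1 <= m < (2 * n).+1) / (t * w - / t * z m).

(* S_i phi_j = phi_(Sidx i j). *)
Definition Sidx (i j : nat) : nat := if j == i then j.-1 else j.

(* (1 + y S_i) phi_j. *)
Definition one_plus_yS (t : C) (n : nat) (z : nat -> C) (y : C) (i j : nat)
    (w : C) : C :=
  phi t n z j w + y * phi t n z (Sidx i j) w.

(* A function on [a, b] is C^1, with one-sided derivatives at the ends, iff it
   extends to a C^1 function g on the line. *)
Definition C1_on (a b : R) (gam : R -> C) : Prop :=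
  exists g dg : R -> C,
    (forall x : R, is_derive (V := C_R_NormedModule) g x (dg x)) /\
    (forall x : R, continuous (U := C_R_NormedModule) dg x) /\
    (forall x : R, (a <= x <= b)%R -> gam x = g x).

Inductive piecewise_C1 (gam : R -> C) : R -> R -> Prop :=
| PC1_piece (a b : R) : (a < b)%R -> C1_on a b gam -> piecewise_C1 gam a b
| PC1_join (a b c : R) :
    piecewise_C1 gam a b -> piecewise_C1 gam b c -> piecewise_C1 gam a c.

Definition contour (gam : R -> C) : Prop :=
  piecewise_C1 gam 0 1 /\ gam 0%R = gam 1%R.

Definition velocity (gam : R -> C) (x : R) : C :=
  (Derive (fun s => Re (gam s)) x, Derive (fun s => Im (gam s)) x).

(* The finitely many corners of gam, where [velocity] is a default value, do
   not affect the integral. *)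
Definition cint (gam : R -> C) (f : C -> C) : C :=
  RInt (V := C_R_CompleteNormedModule)
    (fun s => f (gam s) * velocity gam s) 0 1.

(* The index of gam around p; meaningful for p off the curve. *)
Definition winding (gam : R -> C) (p : C) : C :=
  / (RtoC (2 * PI) * Ci) * cint gam (fun w => / (w - p)).

Definition off_curve (gam : R -> C) (p : C) : Prop :=
  forall s : R, (0 <= s <= 1)%R -> gam s <> p.

Definition encircles_once (gam : R -> C) (p : C) : Prop :=
  off_curve gam p /\ winding gam p = 1.

Definition leaves_outside (gam : R -> C) (p : C) : Prop :=
  off_curve gam p /\ winding gam p = 0.

Definition upd (w : nat -> C) (m : nat) (x : C) : nat -> C :=
  fun k => if k == m then x else w k.

(* Iterated integral of F(w_1, ..., w_n), with w_m on the contour gam m; the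
   innermost integration is over w_1. *)
Fixpoint iter_cint (n : nat) (gam : nat -> R -> C) (F : (nat -> C) -> C) : C :=
  if n is m.+1 then
    cint (gam m.+1)
      (fun x => iter_cint m gam (fun w => F (upd w m.+1 x)))
  else F (fun _ => RtoC 0).

(* Main.v *)
From HB Require Import structures.
Require Import Defs.
From Stdlib Require Import Reals Lra FunctionalExtensionality.
From Coquelicot Require Import Coquelicot.
From mathcomp Require Import ssreflect ssrfun ssrbool eqtype ssrnat seq bigop.
From mathcomp Require Import zify.
Set Implicit Arguments.
Unset Strict Implicit.
Unset Printing Implicit Defensive.
Local Open Scope C_scope.

(** All wave functions have the common denominator
    D(w) = prod_m (w - z_m) (t w - z_m / t), which is symmetric in the z_m:
    phi_i = q_i / D with q_i a polynomial ([wave_num]).  The integrand is thus a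
    polynomial divided by D(w_1) ... D(w_n).  By partial fractions, integrating
    over w_m amounts to a finite sum over w_m = z_1, ..., z_2n, with weights that
    are symmetric in z ([cint_residues], [iter_cint_residues]), and what is to be
    proved becomes an algebraic identity between iterated sums Psi.

    The reason for it is a three-term relation.  Put A = t z_i - z_(i+1) / t and
    B = t z_(i+1) - z_i / t.  Then s_i multiplies Delta_t(z) by B / A, and
    A q_i - B (s_i q_i) = (z_i - z_(i+1)) (q_(i-1) + q_(i+1))
    ([wave_num_exchange]), while the other q_j are symmetric in z_i and z_(i+1).
    When only the slot k, that is the factor in w_(k+1), involves q_i, the
    operator nabla_i on Delta_t(z) Psi turns q_i in that slot into
    q_(i-1) + q_(i+1), and multiplies a q_j with j different from i by
    t + 1/t.  In terms of slots,
    T_i(x) (q_i + Y q_(i-1))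
      = q_(i+1) - [x-1]/[x] q_i + (1 + Y [x+1]/[x]) q_(i-1),
    where the last term disappears if Y = - [x]/[x+1].  This is the
    coefficient that a box with parameter x + 1 leaves, and x + 1 is the
    parameter of the box on the left in the diagram.  So the boxes of a row move
    the index of one slot up by one each ([Tbax_state], [row_agrees]), and the
    last of them leaves the coefficient y_k.

    Two facts about the zeros of the q_i start this process.  As q_i vanishes at
    z_j for j > i, and the Vandermonde factor vanishes when two of the variables
    coincide, a family of slots with indices 1, 2, ..., n leaves only the term
    w_m = z_m, whose value is the function that the operators are applied to
    ([state_base]).  And at the first box of the row of length lambda_k, which
    acts on the slot k, the unwanted term has k + 1
    variables that can only take the k distinct values z_1, ..., z_k, so it is
    zero ([Psi_pigeonhole]).

    The two forms of the integrand agree factor by factor on the contours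
    ([one_plus_yS_closed]). *)

HB.instance Definition _ :=
  Monoid.isComLaw.Build C (RtoC 1) Cmult Cmult_assoc Cmult_comm Cmult_1_l.
HB.instance Definition _ :=
  Monoid.isComLaw.Build C (RtoC 0) Cplus Cplus_assoc Cplus_comm Cplus_0_l.
HB.instance Definition _ :=
  Monoid.isMulLaw.Build C (RtoC 0) Cmult Cmult_0_l Cmult_0_r.
HB.instance Definition _ :=
  Monoid.isAddLaw.Build C Cmult Cplus Cmult_plus_distr_r Cmult_plus_distr_l.

(** * Calculus of complex-valued functions of a real variable *)

Notation cont h s := (continuous (U := C_R_NormedModule) h s).
Notation deriv h s l := (is_derive (V := C_R_NormedModule) h s l).
Notation isint h a b l := (is_RInt (V := C_R_NormedModule) h a b l).

Lemma continuous_pairE (h : R -> C) (s : R) :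
  cont h s <-> continuous (fun x => Re (h x)) s /\ continuous (fun x => Im (h x)) s.
Proof.
split.
- move=> H; split.
  + by apply: (continuous_comp h fst) => //; apply: continuous_fst.
  + by apply: (continuous_comp h snd) => //; apply: continuous_snd.
- case=> H1 H2.
  apply: (continuous_ext (fun x => (Re (h x), Im (h x)))).
    by move=> x; rewrite /Re /Im -surjective_pairing.
  apply: (continuous_comp_2 (U:=R_UniformSpace) (V:=R_UniformSpace) (W:=R_UniformSpace)
      (X:=C_R_NormedModule) (fun x => Re (h x)) (fun x => Im (h x)) (fun x y => (x, y))) => //.
  apply: (continuous_ext (fun x => x)) => [[]//|]; exact: continuous_id.
Qed.

Lemma derive_pairE (h : R -> C) (s : R) (l : C) :
  deriv h s l <-> is_derive (fun x => Re (h x)) s (Re l)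
               /\ is_derive (fun x => Im (h x)) s (Im l).
Proof.
split.
- move=> H; split.
  + apply: (filterdiff_ext_lin _ (fun y : R => Re (scal y l))) => //.
    apply: (filterdiff_comp h fst _ fst) => //; apply: filterdiff_linear; exact: is_linear_fst.
  + apply: (filterdiff_ext_lin _ (fun y : R => Im (scal y l))) => //.
    apply: (filterdiff_comp h snd _ snd) => //; apply: filterdiff_linear; exact: is_linear_snd.
- case=> H1 H2.
  apply: (filterdiff_ext (fun x => (Re (h x), Im (h x)))).
    by move=> x; rewrite /Re /Im -surjective_pairing.
  apply: (filterdiff_ext_lin _ (fun y : R => (scal y (Re l), scal y (Im l)))) => //.
  apply: (filterdiff_comp'_2 (fun x => Re (h x)) (fun x => Im (h x)) (fun x y => (x, y)) s
     (fun y => scal y (Re l)) (fun y => scal y (Im l)) (fun x y => (x, y))) => //.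
  apply: (filterdiff_ext (fun x => x)) => [[]//|].
  apply: (filterdiff_ext_lin _ (fun x => x)) => [|[]//]; exact: filterdiff_id.
Qed.

Lemma is_RInt_pairE (h : R -> C) (a b : R) (l : C) :
  isint h a b l <-> is_RInt (fun x => Re (h x)) a b (Re l)
               /\ is_RInt (fun x => Im (h x)) a b (Im l).
Proof.
split=> [H|[H1 H2]].
  by split; [exact: (is_RInt_fct_extend_fst h)|exact: (is_RInt_fct_extend_snd h)].
by case: l H1 H2 => x y H1 H2; exact: is_RInt_fct_extend_pair.
Qed.

Lemma continuous_Cplus (f g : R -> C) s :
  cont f s -> cont g s -> cont (fun x => f x + g x) s.
Proof. exact: (continuous_plus (V := C_R_NormedModule)). Qed.

Lemma continuous_Cmult (f g : R -> C) s :
  cont f s -> cont g s -> cont (fun x => f x * g x) s.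
Proof.
move=> /continuous_pairE[f1 f2] /continuous_pairE[g1 g2]; apply/continuous_pairE; split.
- by apply: (continuous_minus (V := R_NormedModule)); apply: (continuous_mult (K := R_AbsRing)).
- by apply: (continuous_plus (V := R_NormedModule)); apply: (continuous_mult (K := R_AbsRing)).
Qed.

Lemma normsq_neq0 (x : C) : x <> 0 -> (Re x ^ 2 + Im x ^ 2)%R <> 0%R.
Proof.
case: x => x y /= H H'; apply: H; congr (_, _); nra.
Qed.

Lemma continuous_Cinv (f : R -> C) s :
  cont f s -> f s <> 0 -> cont (fun x => / f x) s.
Proof.
move=> /continuous_pairE[f1 f2] f0.
have n : continuous (fun x => / (Re (f x) ^ 2 + Im (f x) ^ 2))%R s.
  apply: continuous_Rinv_comp; last exact: normsq_neq0.
  apply: (continuous_plus (V := R_NormedModule)).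
    apply: (continuous_ext (fun x => mult (Re (f x)) (Re (f x)))).
      by move=> x; rewrite /= Rmult_1_r.
    exact: (continuous_mult (K := R_AbsRing)).
  apply: (continuous_ext (fun x => mult (Im (f x)) (Im (f x)))).
    by move=> x; rewrite /= Rmult_1_r.
  exact: (continuous_mult (K := R_AbsRing)).
apply/continuous_pairE; split; apply: (continuous_mult (K := R_AbsRing)) => //.
exact: (continuous_opp (V := R_NormedModule)).
Qed.

Lemma is_derive_Cmult (f g : R -> C) s df dg :
  deriv f s df -> deriv g s dg ->
  deriv (fun x => f x * g x) s (df * g s + f s * dg).
Proof.
move=> /derive_pairE[f1 f2] /derive_pairE[g1 g2]; apply/derive_pairE.
have M := (fun u v du dv Hu Hv => @is_derive_mult R_AbsRing u v s du dv Hu Hv Rmult_comm).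
split.
- evar_last; first exact: (is_derive_minus _ _ _ _ _ (M _ _ _ _ f1 g1) (M _ _ _ _ f2 g2)).
  by rewrite /minus /plus /opp /mult /= /Re /Im; ring.
- evar_last; first exact: (is_derive_plus _ _ _ _ _ (M _ _ _ _ f1 g2) (M _ _ _ _ f2 g1)).
  by rewrite /plus /mult /= /Re /Im; ring.
Qed.

Lemma is_RInt_Cplus (f g : R -> C) a b k l :
  isint f a b k -> isint g a b l -> isint (fun x => f x + g x) a b (k + l).
Proof. exact: (is_RInt_plus (V := C_R_NormedModule)). Qed.

Lemma is_RInt_Cmult (c : C) (f : R -> C) a b l :
  isint f a b l -> isint (fun x => c * f x) a b (c * l).
Proof.
move=> /is_RInt_pairE[f1 f2]; apply/is_RInt_pairE.
have M := (fun (k : R) u lu H => @is_RInt_scal R_NormedModule u a b k lu H).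
split.
- exact: (is_RInt_minus (V := R_NormedModule) _ _ _ _ _ _ (M _ _ _ f1) (M _ _ _ f2)).
- exact: (is_RInt_plus (V := R_NormedModule) _ _ _ _ _ _ (M _ _ _ f2) (M _ _ _ f1)).
Qed.

Lemma is_derive_Cpow (f : R -> C) s (df : C) k :
  deriv f s df -> deriv (fun x => Cpow (f x) k.+1) s (NtoC k.+1 * (Cpow (f s) k * df)).
Proof.
move=> Hf; elim: k => [|k IH].
  apply: (is_derive_ext (V := C_R_NormedModule) f) => [x|]; first by rewrite /=; ring.
  by evar_last; [exact: Hf|change (df = NtoC 1 * (1 * df)); rewrite /NtoC /=; ring].
evar_last; first exact: (is_derive_Cmult Hf IH).
rewrite /NtoC (S_INR k.+1) RtoC_plus.
change (df * (f s * Cpow (f s) k) + f s * (RtoC (INR k.+1) * (Cpow (f s) k * df))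
  = (RtoC (INR k.+1) + 1) * (f s * Cpow (f s) k * df)); ring.
Qed.

(** * Contour integrals *)

(** Continuity of a function of a complex variable is only ever needed along
    curves; stated this way, it is stable under the field operations by the
    real-variable lemmas. *)
Definition cts_at (f : C -> C) (p : C) :=
  forall (g : R -> C) (s : R), g s = p -> cont g s -> cont (fun x => f (g x)) s.

Lemma cts_at_const c p : cts_at (fun=> c) p.
Proof. by move=> g s _ _; exact: continuous_const. Qed.

Lemma cts_at_id p : cts_at (fun w => w) p.
Proof. by []. Qed.

Lemma cts_at_plus f g p : cts_at f p -> cts_at g p -> cts_at (fun w => f w + g w) p.
Proof. by move=> Hf Hg h s e H; apply: continuous_Cplus; [exact: Hf|exact: Hg]. Qed.

Lemma cts_at_inv f p : cts_at f p -> f p <> 0 -> cts_at (fun w => / f w) p.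
Proof.
by move=> Hf f0 h s e H; apply: continuous_Cinv; [exact: Hf|rewrite e].
Qed.

Lemma piecewise_C1_lt gam a b : piecewise_C1 gam a b -> (a < b)%R.
Proof. by elim=> [//|x y z _ + _]; lra. Qed.

Lemma velocity_piece (gam g dg : R -> C) (a b : R) :
  (forall x : R, deriv g x (dg x)) ->
  (forall x : R, (a <= x <= b)%R -> gam x = g x) ->
  forall x, (a < x < b)%R -> velocity gam x = dg x.
Proof.
move=> Hg E x Hx; have /derive_pairE[H1 H2] := Hg x.
have Hl : locally x (fun s => gam s = g s).
  have d0 : (0 < Rmin (x - a) (b - x))%R by apply: Rmin_pos; lra.
  exists (mkposreal _ d0) => s /= Hs; apply: E; move: Hs.
  rewrite /ball /= /AbsRing_ball /abs /minus /plus /opp /= => Hs.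
  have := Rmin_l (x - a) (b - x); have := Rmin_r (x - a) (b - x).
  by move: Hs => /Rabs_def2; lra.
rewrite /velocity [RHS]surjective_pairing; congr (_, _).
- apply: is_derive_unique; move: H1; apply: is_derive_ext_loc.
  by apply: filter_imp Hl => s ->.
- apply: is_derive_unique; move: H2; apply: is_derive_ext_loc.
  by apply: filter_imp Hl => s ->.
Qed.

(** The velocity can differ from the derivative of a smooth piece only at the
    endpoints of the piece, which Riemann integrals ignore. *)
Lemma cint_ex (f : C -> C) gam a b : piecewise_C1 gam a b ->
  (forall s, (a <= s <= b)%R -> cts_at f (gam s)) ->
  ex_RInt (V := C_R_NormedModule) (fun s => f (gam s) * velocity gam s) a b.
Proof.
elim=> [{}a {}b ab [g [dg [Hg [Hdg E]]]] Hf|{}a {}b c H1 IH1 H2 IH2 Hf]; last first.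
  have := piecewise_C1_lt H1; have := piecewise_C1_lt H2 => bc ab.
  by apply: (ex_RInt_Chasles _ a b c); [apply: IH1|apply: IH2] => s Hs; apply: Hf; lra.
apply: (ex_RInt_ext (fun s => f (g s) * dg s)) => [x|].
  rewrite Rmin_left ?Rmax_right; [|lra..] => Hx.
  by rewrite (velocity_piece Hg E Hx) E; last lra.
apply: (ex_RInt_continuous (V := C_R_CompleteNormedModule)) => x.
rewrite Rmin_left ?Rmax_right; [|lra..] => Hx.
apply: continuous_Cmult; last exact: Hdg.
apply: Hf; [exact: Hx|by rewrite E|].
by apply: ex_derive_continuous; exists (dg x).
Qed.

Lemma cint_Cpow gam k a b : piecewise_C1 gam a b ->
  isint (fun s => NtoC k.+1 * Cpow (gam s) k * velocity gam s) a b
    (Cpow (gam b) k.+1 - Cpow (gam a) k.+1).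
Proof.
elim=> [{}a {}b ab [g [dg [Hg [Hdg E]]]]|{}a {}b c H1 IH1 H2 IH2]; last first.
  evar_last; first exact: (is_RInt_Chasles _ _ _ _ _ _ IH1 IH2).
  change (@eq C (Cpow (gam b) k.+1 - Cpow (gam a) k.+1
    + (Cpow (gam c) k.+1 - Cpow (gam b) k.+1)) (Cpow (gam c) k.+1 - Cpow (gam a) k.+1)).
  by ring.
apply: (is_RInt_ext (fun s => NtoC k.+1 * (Cpow (g s) k * dg s))) => [x|].
  rewrite Rmin_left ?Rmax_right; [|lra..] => Hx.
  by rewrite (velocity_piece Hg E Hx) E ?Cmult_assoc //; lra.
rewrite (E a) ?(E b); [|lra..].
have Hc x : cont g x by apply: ex_derive_continuous; exists (dg x).
apply: (is_RInt_derive (V := C_R_CompleteNormedModule) (fun s => Cpow (g s) k.+1)) => x _.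
  exact: is_derive_Cpow.
apply: continuous_Cmult; first exact: continuous_const.
apply: continuous_Cmult => //.
elim: k => [|k IH] /=; first exact: continuous_const.
exact: continuous_Cmult.
Qed.

(** The value of an integral, together with the integrability that additivity requires. *)
Definition is_cint (gam : R -> C) (f : C -> C) (l : C) :=
  isint (fun s => f (gam s) * velocity gam s) 0 1 l.

Lemma is_cint_unique gam f l : is_cint gam f l -> cint gam f = l.
Proof. exact: (is_RInt_unique (V := C_R_CompleteNormedModule)). Qed.

Definition on_curve (gam : R -> C) (w : C) := exists2 s, (0 <= s <= 1)%R & w = gam s.

Lemma is_cint_ext gam f g l : (forall w, on_curve gam w -> f w = g w) ->
  is_cint gam f l -> is_cint gam g l.
Proof.
move=> E; apply: is_RInt_ext => x; rewrite Rmin_left ?Rmax_right; [|lra..] => Hx.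
by rewrite E //; exists x => //; lra.
Qed.

Lemma is_cint_plus gam f g k l : is_cint gam f k -> is_cint gam g l ->
  is_cint gam (fun w => f w + g w) (k + l).
Proof.
move=> H1 H2; apply: (is_RInt_ext (V := C_R_NormedModule) _ _ _ _ _ _ (is_RInt_Cplus H1 H2)) => x _.
by rewrite Cmult_plus_distr_r.
Qed.

Lemma is_cint_scal gam c f l : is_cint gam f l -> is_cint gam (fun w => c * f w) (c * l).
Proof.
move=> H1; rewrite /is_cint.
apply: (is_RInt_ext (V := C_R_NormedModule) _ _ _ _ _ _ (is_RInt_Cmult H1)) => x _.
by rewrite Cmult_assoc.
Qed.

Lemma is_cint0 gam : is_cint gam (fun=> 0) 0.
Proof.
apply: (is_RInt_ext (fun=> RtoC 0)) => [x _|]; first by rewrite Cmult_0_l.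
evar_last; first exact: (is_RInt_const (V := C_R_NormedModule)).
exact: (scal_zero_r (V := C_R_NormedModule)).
Qed.

Lemma is_cint_sum gam (f : nat -> C -> C) (l : nat -> C) m n :
  (forall i, (m <= i < n)%N -> is_cint gam (f i) (l i)) ->
  is_cint gam (fun w => \big[Cplus/RtoC 0]_(m <= i < n) f i w)
    (\big[Cplus/RtoC 0]_(m <= i < n) l i).
Proof.
have Z k : (k <= m)%N -> is_cint gam (fun w => \big[Cplus/RtoC 0]_(m <= i < k) f i w)
    (\big[Cplus/RtoC 0]_(m <= i < k) l i).
  move=> km; rewrite big_geq //; apply: (is_cint_ext _ (is_cint0 gam)) => w _.
  by rewrite big_geq.
elim: n => [|n IH] H; first exact: Z.
case: (leqP m n) => [mn|]; last exact: Z.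
rewrite big_nat_recr //=.
apply: (is_cint_ext (f := fun w => \big[Cplus/RtoC 0]_(m <= i < n) f i w + f n w)) => [w _|].
  by rewrite big_nat_recr.
apply: is_cint_plus; last by apply: H; lia.
by apply: IH => // i Hi; apply: H; lia.
Qed.

(** * Polynomial functions *)

(** Polynomial functions in Horner form: division by [w - p] and the vanishing of
    closed integrals are then inductions on the form, with no degrees or
    coefficient sequences. *)
Inductive polyfun (f : C -> C) : Prop :=
| polyfun0 : (forall w, f w = 0) -> polyfun f
| polyfun_horner c g : polyfun g -> (forall w, f w = c + w * g w) -> polyfun f.

Lemma polyfun_ext f g : (forall w, f w = g w) -> polyfun f -> polyfun g.
Proof.
move=> E [H|c h Hh H]; first by apply: polyfun0 => w; rewrite -E.
by apply: (polyfun_horner (c := c) Hh) => w; rewrite -E.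
Qed.

Lemma polyfun_const c : polyfun (fun=> c).
Proof.
by apply: (@polyfun_horner _ c (fun=> 0)) => [|w]; [exact: polyfun0|ring].
Qed.

Lemma polyfun_id : polyfun (fun w => w).
Proof.
by apply: (@polyfun_horner _ 0 (fun=> 1)) => [|w]; [exact: polyfun_const|ring].
Qed.

Lemma polyfun_plus f g : polyfun f -> polyfun g -> polyfun (fun w => f w + g w).
Proof.
move=> Hf; elim: Hf g => {f} [f Hf|f c h Hh IH Hf] g Hg.
  by apply: polyfun_ext Hg => w; rewrite Hf; ring.
case: Hg => [Hg|d k Hk Hg].
  by apply: (polyfun_horner (c := c) Hh) => w; rewrite Hf Hg; ring.
by apply: (polyfun_horner (c := c + d) (IH _ Hk)) => w; rewrite Hf Hg; ring.
Qed.

Lemma polyfun_scal c f : polyfun f -> polyfun (fun w => c * f w).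
Proof.
elim=> {f} [f Hf|f d h Hh IH Hf]; first by apply: polyfun0 => w; rewrite Hf; ring.
by apply: (polyfun_horner (c := c * d) IH) => w; rewrite Hf; ring.
Qed.

Lemma polyfun_mult f g : polyfun f -> polyfun g -> polyfun (fun w => f w * g w).
Proof.
move=> Hf Hg; elim: Hf => {f} [f Hf|f c h Hh IH Hf].
  by apply: polyfun0 => w; rewrite Hf; ring.
apply: (polyfun_ext (f := fun w => c * g w + (0 + w * (h w * g w)))).
  by move=> w; rewrite Hf; ring.
apply: polyfun_plus; first exact: polyfun_scal.
by apply: (polyfun_horner (c := 0) IH).
Qed.

Lemma polyfun_sum (F : nat -> C -> C) m n : (forall i, polyfun (F i)) ->
  polyfun (fun w => \big[Cplus/RtoC 0]_(m <= i < n) F i w).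
Proof.
move=> H; rewrite /index_iota; elim: iota => [|i s IH].
  by apply: polyfun0 => w; rewrite big_nil.
apply: (polyfun_ext (f := fun w => F i w + \big[Cplus/RtoC 0]_(i <- s) F i w)).
  by move=> w; rewrite big_cons.
exact: polyfun_plus.
Qed.

Lemma polyfun_prod (F : nat -> C -> C) m n : (forall i, polyfun (F i)) ->
  polyfun (fun w => \big[Cmult/RtoC 1]_(m <= i < n) F i w).
Proof.
move=> H; rewrite /index_iota; elim: iota => [|i s IH].
  by apply: polyfun_ext (polyfun_const 1) => w; rewrite big_nil.
apply: (polyfun_ext (f := fun w => F i w * \big[Cmult/RtoC 1]_(i <- s) F i w)).
  by move=> w; rewrite big_cons.
exact: polyfun_mult.
Qed.

Lemma polyfun_divides f p : polyfun f ->
  exists2 g, polyfun g & forall w, f w = f p + (w - p) * g w.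
Proof.
elim=> {f} [f Hf|f c h Hh [g Hg Eg] Hf].
  by exists (fun=> 0) => [|w]; [exact: polyfun_const|rewrite !Hf; ring].
exists (fun w => h w + p * g w).
  by apply: polyfun_plus => //; exact: polyfun_scal.
by move=> w; rewrite !Hf (Eg w); ring.
Qed.

Lemma NtoC_neq0 k : NtoC k.+1 <> 0.
Proof. by move=> /(f_equal fst); exact: not_0_INR. Qed.

(** Each [(k + 1) w ^ k] has the primitive [w ^ (k + 1)], whose increment along
    a closed curve is zero; the extra power of [w] makes the induction on the
    Horner form go through. *)
Lemma cint_polyfun gam f : contour gam -> polyfun f -> is_cint gam f 0.
Proof.
move=> [Hp Hc] Hf.
suff H k : is_cint gam (fun w => Cpow w k * f w) 0.
  by apply: (is_cint_ext _ (H 0%N)) => w _ /=; ring.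
elim: Hf k => {f} [f Hf|f c h Hh IH Hf] k.
  by apply: (is_cint_ext _ (is_cint0 gam)) => w _; rewrite Hf; ring.
have H : is_cint gam (fun w => NtoC k.+1 * Cpow w k) 0.
  by have := cint_Cpow (k := k) Hp; rewrite -Hc /Cminus Cplus_opp_r.
have := is_cint_plus (is_cint_scal (c := c / NtoC k.+1) H) (IH k.+1).
rewrite Cmult_0_r Cplus_0_l; apply: is_cint_ext => w _.
by rewrite Hf /=; field; exact: NtoC_neq0.
Qed.

(** * Residues *)

Definition twopii : C := RtoC (2 * PI) * Ci.

Lemma twopii_neq0 : twopii <> 0.
Proof.
apply: Cmult_neq_0 => [/RtoC_inj|[/R1_neq_R0//]].
by have := PI_RGT_0; lra.
Qed.

Lemma Cinv_mult (a b : C) : / (a * b) = / a * / b.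
Proof.
have C0 : / RtoC 0 = 0 by rewrite /Cinv /=; congr (_, _); rewrite /Rdiv; ring.
case: (Ceq_dec a 0) => [->|a0]; first by rewrite Cmult_0_l C0 Cmult_0_l.
case: (Ceq_dec b 0) => [->|b0]; first by rewrite Cmult_0_r C0 Cmult_0_r.
by field.
Qed.

(** Dividing [f] by [w - p] leaves a polynomial, which integrates to zero, and
    the remainder [f p] times the integrand that defines the index of the curve. *)
Lemma cint_pole gam f p chi : contour gam -> polyfun f -> off_curve gam p ->
  winding gam p = chi -> is_cint gam (fun w => f w / (w - p)) (twopii * chi * f p).
Proof.
move=> Hc Hf Hp <-.
have [g Hg Eg] := polyfun_divides p Hf.
have W : is_cint gam (fun w => / (w - p)) (twopii * winding gam p).
  have -> : twopii * winding gam p = cint gam (fun w => / (w - p)).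
    by rewrite /winding -/twopii; field; exact: twopii_neq0.
  refine (RInt_correct (V := C_R_CompleteNormedModule) _ _ _ _).
  apply: (cint_ex (f := fun w => / (w - p)) (proj1 Hc)) => s Hs.
  apply: cts_at_inv; last by apply: Cminus_eq_contra; exact: Hp.
  by apply: cts_at_plus; [exact: cts_at_id|exact: cts_at_const].
have := is_cint_plus (cint_polyfun Hc Hg) (is_cint_scal (c := f p) W).
rewrite Cplus_0_l Cmult_comm; apply: is_cint_ext => w [s Hs ->].
by rewrite (Eg (gam s)); field; apply: Cminus_eq_contra; exact: Hp.
Qed.

(** The residue of [1 / ((w - p 1) ... (w - p N))] at a pole [x].  Skipping the
    factor that vanishes at [x], instead of the one with the index of [x], makes
    the expression symmetric in the poles at sight. *)
Definition residue_wt (N : nat) (p : nat -> C) (x : C) : C :=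
  / \big[Cmult/RtoC 1]_(1 <= j < N.+1) (if Ceq_dec x (p j) then RtoC 1 else x - p j).

Lemma prod_neq0 (F : nat -> C) m n : (forall i, (m <= i < n)%N -> F i <> 0) ->
  \big[Cmult/RtoC 1]_(m <= i < n) F i <> 0.
Proof.
move=> H; rewrite big_seq; elim/big_rec: _ => [|i x]; first exact: C1_nz.
by rewrite mem_index_iota => Hi Hx; apply: Cmult_neq_0 => //; exact: H.
Qed.

(** In the step from [N] to [N + 1] poles, each old residue is divided by
    [p i - p (N + 1)], and the residue at the new pole is the left-hand side of
    the identity for [N] poles, evaluated at the new pole. *)
Lemma partial_fractions N (p : nat -> C) (w : C) : (0 < N)%N ->
  (forall i j, (1 <= i < j)%N -> (j <= N)%N -> p i <> p j) ->
  (forall i, (1 <= i <= N)%N -> w <> p i) ->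
  / (\big[Cmult/RtoC 1]_(1 <= i < N.+1) (w - p i))
  = \big[Cplus/RtoC 0]_(1 <= i < N.+1) (residue_wt N p (p i) / (w - p i)).
Proof.
elim: N w => // -[|N] IH w _ Hp Hw.
  rewrite !big_nat1 /residue_wt big_nat1; case: Ceq_dec => [?|[]//] /=.
  by field; apply: Cminus_eq_contra; exact: Hw.
have IH' x : (forall i, (1 <= i <= N.+1)%N -> x <> p i) -> _ :=
  IH x isT (fun i j Hij Hj => Hp i j Hij (leqW Hj)).
have PN : forall i, (1 <= i <= N.+1)%N -> p N.+2 <> p i.
  by move=> i Hi H; apply: (Hp i N.+2) => //; lia.
have E i : (1 <= i < N.+2)%N ->
   residue_wt N.+2 p (p i) = residue_wt N.+1 p (p i) / (p i - p N.+2).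
  move=> Hi; rewrite /residue_wt big_nat_recr //=.
  case: Ceq_dec => [H|?] /=; first by case: (PN i).
  by rewrite /Cdiv Cinv_mult.
have EN : residue_wt N.+2 p (p N.+2) = / (\big[Cmult/RtoC 1]_(1 <= i < N.+2) (p N.+2 - p i)).
  rewrite /residue_wt big_nat_recr //=; case: Ceq_dec => [?|[]//] /=; rewrite Cmult_1_r.
  by congr (/ _); apply: eq_big_nat => i Hi; case: Ceq_dec => // H; case: (PN i).
rewrite big_nat_recr //= Cinv_mult IH'; last by move=> i Hi; apply: Hw; lia.
rewrite [RHS]big_nat_recr //= EN (IH' _ PN) /Cdiv !big_distrl /= -big_split /=.
apply: eq_big_nat => i Hi; rewrite E //.
field; repeat split; apply: Cminus_eq_contra.
- by apply: Hw; lia.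
- by apply: PN.
- by apply: Hw; lia.
- by apply: (Hp i N.+2); lia.
Qed.

Definition inner_poles (N : nat) (z : nat -> C) (w : C) : C :=
  \big[Cmult/RtoC 1]_(1 <= m < N.+1) (w - z m).
Definition outer_poles (t : C) (N : nat) (z : nat -> C) (w : C) : C :=
  \big[Cmult/RtoC 1]_(1 <= m < N.+1) (t * w - / t * z m).

(** Partial fractions are taken separately in [w], over the [z i], and in [t w],
    over the [z m / t].  A product of two simple fractions is again a difference
    of simple fractions, one with its pole at [z i], of index 1, and one with its
    pole at [z m / t ^ 2], of index 0; the terms of the first kind are then summed
    over [m] by partial fractions read backwards. *)
Lemma cint_residues (t : C) (N : nat) (z : nat -> C) gam f :
  t <> 0 -> (0 < N)%N ->
  (forall i j, (1 <= i < j)%N -> (j <= N)%N -> z i <> z j) ->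
  contour gam ->
  (forall i, (1 <= i <= N)%N -> encircles_once gam (z i)) ->
  (forall i, (1 <= i <= N)%N -> leaves_outside gam (/ (t * t) * z i)) ->
  polyfun f ->
  is_cint gam (fun w => f w / (inner_poles N z w * outer_poles t N z w))
   (twopii * \big[Cplus/RtoC 0]_(1 <= i < N.+1)
      (f (z i) * (residue_wt N z (z i) / outer_poles t N z (z i)))).
Proof.
move=> t0 N0 Hz Hc Hin Hout Hf.
have tt0 : t * t <> 0 by exact: Cmult_neq_0.
pose r m := / t * z m.
have Hr i j : (1 <= i < j)%N -> (j <= N)%N -> r i <> r j.
  move=> ij jN H; apply: (Hz i j) => //.
  have -> : z i = t * r i by rewrite /r; field.
  by rewrite H /r; field.
have zq i j : (1 <= i <= N)%N -> (1 <= j <= N)%N -> z i <> / (t * t) * z j.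
  move=> Hi Hj H; have [_] := Hin _ Hi; have [_] := Hout _ Hj.
  by rewrite H => -> /RtoC_inj; lra.
have zr i j : (1 <= i <= N)%N -> (1 <= j <= N)%N -> t * z i - r j <> 0.
  move=> Hi Hj H; apply: (zq i j) => //.
  have -> : z i = / t * (t * z i - r j) + / t * r j by field.
  by rewrite H /r; field.
pose F i m w := residue_wt N z (z i) * residue_wt N r (r m) / (t * z i - r m)
   * (f w / (w - z i) + (- 1) * (f w / (w - / (t * t) * z m))).
pose L i m := residue_wt N z (z i) * residue_wt N r (r m) / (t * z i - r m)
   * (twopii * 1 * f (z i) + (-1) * (twopii * 0 * f (/ (t * t) * z m))).
have H : is_cint gam
   (fun w => \big[Cplus/RtoC 0]_(1 <= i < N.+1) \big[Cplus/RtoC 0]_(1 <= m < N.+1) F i m w)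
   (\big[Cplus/RtoC 0]_(1 <= i < N.+1) \big[Cplus/RtoC 0]_(1 <= m < N.+1) L i m).
  apply: is_cint_sum => i Hi; apply: is_cint_sum => m Hm.
  apply: is_cint_scal; apply: is_cint_plus.
    by have [? ?] := Hin i Hi; apply: cint_pole.
  by apply: is_cint_scal; have [? ?] := Hout m Hm; apply: cint_pole.
have P w : (forall m, (1 <= m <= N)%N -> t * w <> r m) ->
  / outer_poles t N z w = \big[Cplus/RtoC 0]_(1 <= m < N.+1) (residue_wt N r (r m) / (t * w - r m)).
  by move=> Hw; rewrite -partial_fractions.
have -> : twopii * \big[Cplus/RtoC 0]_(1 <= i < N.+1)
      (f (z i) * (residue_wt N z (z i) / outer_poles t N z (z i)))
    = \big[Cplus/RtoC 0]_(1 <= i < N.+1) \big[Cplus/RtoC 0]_(1 <= m < N.+1) L i m.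
  rewrite big_distrr /=; apply: eq_big_nat => i Hi.
  rewrite /Cdiv P; last by move=> m Hm H'; apply: (zr i m) => //; rewrite H'; ring.
  rewrite !big_distrr /=; apply: eq_big_nat => m Hm; rewrite /L; field; exact: zr.
apply: is_cint_ext H => w [s Hs ->] {w}; set w := gam s.
have wz m : (1 <= m <= N)%N -> w - z m <> 0.
  by move=> Hm; apply: Cminus_eq_contra; have [H _] := Hin _ Hm; exact: H.
have wq m : (1 <= m <= N)%N -> w - / (t * t) * z m <> 0.
  by move=> Hm; apply: Cminus_eq_contra; have [H _] := Hout _ Hm; exact: H.
have wr m : (1 <= m <= N)%N -> t * w - r m <> 0.
  have -> : t * w - r m = t * (w - / (t * t) * z m) by rewrite /r; field.
  by move=> Hm; apply: Cmult_neq_0 => //; exact: wq.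
rewrite /Cdiv Cinv_mult [/ inner_poles _ _ _]partial_fractions //; last first.
  by move=> i Hi H; apply: (wz i Hi); rewrite H; ring.
rewrite P; last by move=> m Hm H; apply: (wr m Hm); rewrite H; ring.
rewrite big_distrl big_distrr /=; apply: eq_big_nat => i Hi.
rewrite !big_distrr /=; apply: eq_big_nat => m Hm; rewrite /F.
have := wq m Hm; have := wr m Hm; have := wz i Hi; have := zr i m Hi Hm.
have -> : / (t * t) * z m = / t * r m by rewrite /r; field.
move=> h1 h2 h3 h4; field; repeat split => //.
Qed.

(** * Iterated residues *)

Definition res_sum (t : C) (N : nat) (z : nat -> C) (f : C -> C) : C :=
  \big[Cplus/RtoC 0]_(1 <= i < N.+1)
    (f (z i) * (residue_wt N z (z i) / outer_poles t N z (z i))).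

Fixpoint iter_res (t : C) (N : nat) (z : nat -> C) (n : nat) (F : (nat -> C) -> C) : C :=
  if n is m.+1 then res_sum t N z (fun x => iter_res t N z m (fun w => F (upd w m.+1 x)))
  else F (fun _ => RtoC 0).

Lemma iter_res_lin t N z n a b F F1 F2 :
  (forall w, F w = a * F1 w + b * F2 w) ->
  iter_res t N z n F = a * iter_res t N z n F1 + b * iter_res t N z n F2.
Proof.
elim: n F F1 F2 => [|n IH] F F1 F2 H //=.
rewrite /res_sum !big_distrr /= -big_split /=; apply: eq_big_nat => i _.
rewrite (IH _ (fun w => F1 (upd w n.+1 (z i))) (fun w => F2 (upd w n.+1 (z i)))) //.
by rewrite /Cdiv; ring.
Qed.

Arguments iter_res_lin {t N z n} a b {F} F1 F2 _.

Lemma iter_res_scal t N z n a F F1 : (forall w, F w = a * F1 w) ->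
  iter_res t N z n F = a * iter_res t N z n F1.
Proof.
move=> H; rewrite (iter_res_lin a 0 F1 F1).
  by ring.
by move=> w; rewrite H; ring.
Qed.

Arguments iter_res_scal {t N z n} a {F} F1 _.

Lemma iter_res_ext t N z n F F1 : (forall w, F w = F1 w) ->
  iter_res t N z n F = iter_res t N z n F1.
Proof. by move=> H; rewrite (functional_extensionality _ _ H). Qed.

Lemma polyfun_iter_res t N z n (H : C -> (nat -> C) -> C) :
  (forall w, polyfun (fun x => H x w)) -> polyfun (fun x => iter_res t N z n (H x)).
Proof.
elim: n H => [|n IH] H Hp /=; first exact: Hp.
apply: polyfun_sum => i; apply: polyfun_mult; last exact: polyfun_const.
by apply: IH => w; apply: Hp.
Qed.

Definition separately_poly (G : (nat -> C) -> C) : Prop :=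
  forall m w, polyfun (fun x => G (upd w m x)).

Lemma separately_poly_upd G m y :
  separately_poly G -> separately_poly (fun w => G (upd w m y)).
Proof.
move=> H k w; case: (k =P m) => [->|km].
  apply: (polyfun_ext (f := fun=> G (upd w m y))); last exact: polyfun_const.
  move=> x; congr G; apply: functional_extensionality => i; rewrite /upd.
  by case: ifP.
apply: polyfun_ext (H k (upd w m y)) => x.
congr G; apply: functional_extensionality => i; rewrite /upd.
by case: eqP => // ->; case: eqP.
Qed.

Section IteratedContours.
Variables (t : C) (N : nat) (z : nat -> C) (gam : nat -> R -> C).
Hypothesis t0 : t <> 0.
Hypothesis N0 : (0 < N)%N.
Hypothesis z_uniq : forall i j, (1 <= i < j)%N -> (j <= N)%N -> z i <> z j.

Let D w := inner_poles N z w * outer_poles t N z w.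

(** The numerator has to be a polynomial in each variable, for then the result
    of the inner integrations is a polynomial in the outermost variable, and
    [cint_residues] applies again. *)
Lemma iter_cint_residues n F G :
  (forall m, (1 <= m <= n)%N -> contour (gam m)) ->
  (forall m i, (1 <= m <= n)%N -> (1 <= i <= N)%N -> encircles_once (gam m) (z i)) ->
  (forall m i, (1 <= m <= n)%N -> (1 <= i <= N)%N ->
     leaves_outside (gam m) (/ (t * t) * z i)) ->
  separately_poly G ->
  (forall w, (forall m, (1 <= m <= n)%N -> on_curve (gam m) (w m)) ->
    F w = G w / \big[Cmult/RtoC 1]_(1 <= m < n.+1) D (w m)) ->
  iter_cint n gam F = Cpow twopii n * iter_res t N z n G.
Proof.
elim: n F G => [|n IH] F G Hc Hin Hout HG HF /=.
  by rewrite HF; [rewrite big_geq //; field; exact: C1_nz|move=> m; lia].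
pose f x := Cpow twopii n * iter_res t N z n (fun w => G (upd w n.+1 x)).
have Hf : polyfun f by apply/polyfun_scal/polyfun_iter_res => w; exact: HG.
have /is_cint_unique E := cint_residues t0 N0 z_uniq (Hc n.+1 ltac:(lia))
   (fun i Hi => Hin n.+1 i ltac:(lia) Hi) (fun i Hi => Hout n.+1 i ltac:(lia) Hi) Hf.
transitivity (cint (gam n.+1) (fun w => f w / D w)); last first.
  rewrite E -Cmult_assoc; congr (_ * _).
  rewrite /res_sum big_distrr /=; apply: eq_big_nat => i _.
  by rewrite /f /Cdiv; ring.
apply: (RInt_ext (V := C_R_CompleteNormedModule)) => s.
rewrite Rmin_left ?Rmax_right; [|lra..] => Hs.
congr (_ * _); set x := gam n.+1 s.
rewrite (IH _ (fun w => / D x * G (upd w n.+1 x))).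
- rewrite (iter_res_scal (/ D x) (fun w => G (upd w n.+1 x))) //.
  by rewrite /f /Cdiv; ring.
- by move=> m Hm; apply: Hc; lia.
- by move=> m i Hm; apply: Hin; lia.
- by move=> m i Hm; apply: Hout; lia.
- by move=> m w; apply/polyfun_scal/separately_poly_upd.
- move=> w Hw; rewrite HF.
    have -> : \big[Cmult/RtoC 1]_(1 <= m < n.+2) D (upd w n.+1 x m)
        = (\big[Cmult/RtoC 1]_(1 <= m < n.+1) D (w m)) * D x.
      rewrite big_nat_recr //= {2}/upd eqxx; congr (_ * _).
      by apply: eq_big_nat => i Hi; rewrite /upd ifN //; lia.
    by rewrite /Cdiv Cinv_mult; ring.
  move=> m Hm; rewrite /upd; case: eqP => [->|mn]; last by apply: Hw; lia.
  by exists s => //; lra.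
Qed.
End IteratedContours.

(** * Collapse of iterated residues *)

Lemma prod_eq0 (F : nat -> C) m n i : (m <= i < n)%N -> F i = 0 ->
  \big[Cmult/RtoC 1]_(m <= k < n) F k = 0.
Proof.
move=> Hi F0; rewrite (bigD1_seq i) ?mem_index_iota ?iota_uniq //=.
by rewrite F0 Cmult_0_l.
Qed.

Lemma sum_single (F : nat -> C) m n i : (m <= i < n)%N ->
  (forall k, (m <= k < n)%N -> k <> i -> F k = 0) ->
  \big[Cplus/RtoC 0]_(m <= k < n) F k = F i.
Proof.
move=> Hi F0; rewrite (bigD1_seq i) ?mem_index_iota ?iota_uniq //=.
rewrite big_seq_cond big1 ?Cplus_0_r // => k.
by rewrite mem_index_iota => /andP[Hk /eqP]; exact: F0.
Qed.

(** Among the values [w_i = z_j], these conditions leave only [w_i = z_i]: [w_1]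
    has to be [z_1], then [w_2] is [z_1] or [z_2] and differs from [w_1], and so
    on up to [w_K]. *)
Definition confined (N : nat) (z : nat -> C) (K : nat) (F : (nat -> C) -> C) :
    Prop :=
  (forall w i j, (1 <= i < j)%N -> (j <= K)%N -> w i = w j -> F w = 0) /\
  (forall w i j, (1 <= i <= K)%N -> (i < j <= N)%N -> w i = z j -> F w = 0).

Definition diagonal (z : nat -> C) (K : nat) : nat -> C :=
  fun i => if (1 <= i <= K)%N then z i else 0.

(** The outermost variable is [w_K].  By induction the others sit at
    [z_1, ..., z_(K-1)], so distinctness excludes these values for [w_K], and
    confinement excludes the values beyond [z_K]. *)
Lemma iter_res_collapse t N z K F : (K <= N)%N -> confined N z K F ->
  iter_res t N z K F =
  \big[Cmult/RtoC 1]_(1 <= i < K.+1) (residue_wt N z (z i) / outer_poles t N z (z i))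
  * F (diagonal z K).
Proof.
elim: K F => [|K IH] F KN [H1 H2] /=.
  rewrite big_geq // Cmult_1_l; congr F; apply: functional_extensionality => -[|i];
  by rewrite /diagonal.
rewrite /res_sum (sum_single (i := K.+1)); last first.
- move=> i Hi iK; rewrite IH; last 1 first.
  + split=> w j k Hj Hk E.
      by apply: (H1 _ j k) => //; rewrite /upd ?ifN //; lia.
    by apply: (H2 _ j k) => //; rewrite /upd ?ifN //; lia.
  + rewrite (_ : F _ = 0); first by rewrite !Cmult_0_r Cmult_0_l.
    case: (ltngtP i K.+1) => // Hi'.
      apply: (H1 _ i K.+1) => //; first by lia.
      by rewrite /upd eqxx /diagonal ifN ?ifT //; lia.
    by apply: (H2 _ K.+1 i); rewrite /upd ?eqxx //; lia.
  + by lia.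
- by lia.
rewrite IH; last 1 first.
- split=> w j k Hj Hk E.
    by apply: (H1 _ j k) => //; rewrite /upd ?ifN //; lia.
  by apply: (H2 _ j k) => //; rewrite /upd ?ifN //; lia.
- rewrite [in RHS]big_nat_recr //= (_ : upd _ _ _ = diagonal z K.+1); first by ring.
  apply: functional_extensionality => i; rewrite /upd /diagonal.
  case: eqP => [->|iK]; first by rewrite ifT //; lia.
  by case: ifP => Hi; case: ifP => //; lia.
- by lia.
Qed.

(** The variables after [w_K] are summed outside and stay fixed while the first
    [K] collapse to [w_i = z_i]. *)
Lemma iter_res_eq0 t N z K n F : (1 <= K <= N)%N -> (K <= n)%N -> confined N z K F ->
  (forall w, w K = z K -> F w = 0) -> iter_res t N z n F = 0.
Proof.
move=> HK; elim: n F => [|n IH] F Kn HF H3; first by lia.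
case: (ltngtP K n.+1) Kn => // [Kn _|E _].
  rewrite /= /res_sum big_nat_cond big1 // => i _.
  rewrite IH ?Cmult_0_l //.
    case: HF => H1 H2; split=> w j k Hj Hk E.
      by apply: (H1 _ j k) => //; rewrite /upd ?ifN //; lia.
    by apply: (H2 _ j k) => //; rewrite /upd ?ifN //; lia.
  by move=> w E; apply: H3; rewrite /upd ifN //; lia.
rewrite -E iter_res_collapse //; last by lia.
by rewrite H3 ?Cmult_0_r // /diagonal ifT //; lia.
Qed.

(** * Exchanging two neighbouring variables *)

Lemma swap_l i z : swap i z i = z i.+1.
Proof. by rewrite /swap eqxx. Qed.

Lemma swap_r i z : swap i z i.+1 = z i.
Proof. by rewrite /swap eqxx ifN //; lia. Qed.

Lemma swap_out i z m : (m < i)%N || (i.+1 < m)%N -> swap i z m = z m.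
Proof. by move=> H; rewrite /swap !ifN //; lia. Qed.

Section Swap.
Variables (R : Type) (idx : R) (op : Monoid.com_law idx).

Lemma big_nat_two (F : nat -> R) a b i : (a <= i)%N -> (i.+1 < b)%N ->
  \big[op/idx]_(a <= m < b) F m =
  op (op (F i) (F i.+1))
     (op (\big[op/idx]_(a <= m < i) F m) (\big[op/idx]_(i.+2 <= m < b) F m)).
Proof.
move=> ai ib; rewrite (big_cat_nat (n := i)) //=; last by lia.
rewrite (big_ltn (m := i)); last by lia.
rewrite (big_ltn (m := i.+1)) // -Monoid.mulmA [LHS]Monoid.mulmCA.
congr (op _ _); exact: Monoid.mulmCA.
Qed.

Lemma big_swap (G : C -> R) z i a b : (a <= i)%N -> (i.+1 < b)%N ->
  \big[op/idx]_(a <= m < b) G (swap i z m) = \big[op/idx]_(a <= m < b) G (z m).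
Proof.
move=> ai ib; rewrite !(big_nat_two _ ai ib) swap_l swap_r (Monoid.mulmC op (G (z i.+1))).
congr (op _ (op _ _)); apply: eq_big_nat => m Hm; rewrite swap_out //; lia.
Qed.

Lemma big_swap_out (G : C -> R) z i a b : (b <= i)%N || (i.+1 < a)%N ->
  \big[op/idx]_(a <= m < b) G (swap i z m) = \big[op/idx]_(a <= m < b) G (z m).
Proof.
by move=> H; apply: eq_big_nat => m Hm; rewrite swap_out //; lia.
Qed.
End Swap.

Lemma res_sum_swap t N z i f : (1 <= i)%N -> (i < N)%N ->
  res_sum t N (swap i z) f = res_sum t N z f.
Proof.
move=> i1 iN.
have W x : residue_wt N (swap i z) x = residue_wt N z x.
  rewrite /residue_wt; congr (/ _).
  by rewrite (big_swap _ (fun y => if Ceq_dec x y then RtoC 1 else x - y)).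
have O x : outer_poles t N (swap i z) x = outer_poles t N z x.
  by rewrite /outer_poles (big_swap _ (fun y => t * x - / t * y)).
rewrite /res_sum.
rewrite (eq_bigr (fun m => f (swap i z m) * (residue_wt N z (swap i z m)
   / outer_poles t N z (swap i z m)))); last by move=> m _; rewrite W O.
by rewrite (big_swap _ (fun y => f y * (residue_wt N z y / outer_poles t N z y))).
Qed.

(** The sum runs over all poles with symmetric weights, so only the summand can
    depend on their order. *)
Lemma iter_res_swap t N z n i F : (1 <= i)%N -> (i < N)%N ->
  iter_res t N (swap i z) n F = iter_res t N z n F.
Proof.
move=> i1 iN; elim: n F => [//|n IH] F /=; rewrite res_sum_swap //.
by congr res_sum; apply: functional_extensionality => x; rewrite IH.
Qed.

Lemma Delta_t_swap t N z i : (1 <= i)%N -> (i < N)%N ->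
  (t * z i - / t * z i.+1) * Delta_t t N (swap i z)
  = (t * z i.+1 - / t * z i) * Delta_t t N z.
Proof.
move=> i1 iN; rewrite /Delta_t !(big_nat_two _ _ i1 (iN : (i.+1 < N.+1)%N)).
rewrite !(big_nat_recr i) //= swap_l swap_r.
rewrite !(big_swap_out _ (fun y => t * y - / t * _)) ?leqnn //.
have -> : \big[Cmult/RtoC 1]_(1 <= j < i) \big[Cmult/RtoC 1]_(1 <= k < j)
    (t * swap i z k - / t * swap i z j)
  = \big[Cmult/RtoC 1]_(1 <= j < i) \big[Cmult/RtoC 1]_(1 <= k < j) (t * z k - / t * z j).
  apply: eq_big_nat => j Hj; rewrite swap_out; last by lia.
  by rewrite (big_swap_out _ (fun y => t * y - / t * _)) //; lia.
have -> : \big[Cmult/RtoC 1]_(i.+2 <= j < N.+1) \big[Cmult/RtoC 1]_(1 <= k < j)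
    (t * swap i z k - / t * swap i z j)
  = \big[Cmult/RtoC 1]_(i.+2 <= j < N.+1) \big[Cmult/RtoC 1]_(1 <= k < j) (t * z k - / t * z j).
  apply: eq_big_nat => j Hj; rewrite swap_out; last by lia.
  by rewrite (big_swap _ (fun y => t * y - / t * _)) //; lia.
by rewrite /=; ring.
Qed.

(** The numerator of the wave function [phi_k] over the common denominator of
    all of them, which is symmetric in the [z_m]. *)
Definition wave_num (t : C) (N : nat) (z : nat -> C) (k : nat) (w : C) : C :=
  \big[Cmult/RtoC 1]_(1 <= m < k.+1) (t * w - / t * z m)
  * \big[Cmult/RtoC 1]_(k.+1 <= m < N.+1) (w - z m).

Lemma wave_num_swap t N z i k w : (1 <= i)%N -> (i < N)%N -> k <> i ->
  wave_num t N (swap i z) k w = wave_num t N z k w.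
Proof.
move=> i1 iN ki; rewrite /wave_num; case: (leqP i k) => ik.
  rewrite (big_swap _ (fun y => t * w - / t * y)) //; last by lia.
  by rewrite (big_swap_out _ (fun y => w - y)) //; lia.
rewrite (big_swap _ (fun y => w - y)) //.
by rewrite (big_swap_out _ (fun y => t * w - / t * y)) //; lia.
Qed.

(** The source of the index shifts.  Without the factors common to all terms this
    is an identity between quadratic polynomials in [w]: [q_(i-1)], [q_i] and
    [q_(i+1)] have 0, 1 and 2 of their two factors for [z_i] and [z_(i+1)] of the
    form [t w - z / t]. *)
Lemma wave_num_exchange (t : C) N z i w : t <> 0 -> (1 <= i)%N -> (i < N)%N ->
  (t * z i - / t * z i.+1) * wave_num t N z i w
  - (t * z i.+1 - / t * z i) * wave_num t N (swap i z) i w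
  = (z i - z i.+1) * (wave_num t N z i.-1 w + wave_num t N z i.+1 w).
Proof.
move=> t0 i1 iN; rewrite /wave_num (prednK i1).
rewrite !(big_nat_recr i) //= !(big_nat_recr i.+1) //= !(big_nat_recr i) //=.
rewrite (big_swap_out _ (fun y => t * w - / t * y)) ?leqnn //.
rewrite (big_ltn (m := i)); last by lia.
rewrite !(big_ltn (m := i.+1)) //.
rewrite (big_swap_out _ (fun y => w - y)); last by lia.
rewrite swap_l swap_r /=; field; exact: t0.
Qed.

Lemma wave_num_eq0 t N z k j : (k < j <= N)%N -> wave_num t N z k (z j) = 0.
Proof.
move=> H; rewrite /wave_num [X in _ * X](prod_eq0 (i := j)) ?Cmult_0_r //; ring.
Qed.

(** * Quantum numbers *)

Lemma CexpD x y : Cexp (x + y) = Cexp x * Cexp y.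
Proof.
by rewrite /Cexp /Cmult /Re /Im /= exp_plus cos_plus sin_plus; congr (_, _); ring.
Qed.

Section QuantumNumbers.
Variables (t logt : C).
Hypothesis t0 : t <> 0.
Hypothesis logtE : Cexp logt = t.

Lemma tpowD x y : tpow logt (x + y) = tpow logt x * tpow logt y.
Proof. by rewrite /tpow Cmult_plus_distr_l CexpD. Qed.

Lemma tpow1 : tpow logt 1 = t.
Proof. by rewrite /tpow Cmult_1_r. Qed.

Lemma tpow0 : tpow logt 0 = 1.
Proof.
by rewrite /tpow Cmult_0_r /Cexp /= exp_0 cos_0 sin_0; congr (_, _); ring.
Qed.

Lemma tpowN1 : tpow logt (- (1)) = / t.
Proof.
have := tpowD (- (1)) 1; rewrite tpow1 (_ : - (1) + 1 = 0); last by ring.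
rewrite tpow0 => E; transitivity (tpow logt (- (1)) * t * / t); first by field.
by rewrite -E Cmult_1_l.
Qed.

Lemma tnumD1 x :
  tnum t logt (x + 1) = (tpow logt x * t - tpow logt (- x) * / t) / (t - / t).
Proof.
rewrite /tnum tpowD tpow1 (_ : - (x + 1) = - x + - (1)); last by ring.
by rewrite tpowD tpowN1.
Qed.

Lemma tnumB1 x :
  tnum t logt (x - 1) = (tpow logt x * / t - tpow logt (- x) * t) / (t - / t).
Proof.
rewrite /tnum (_ : x - 1 = x + - (1)); last by ring.
rewrite tpowD tpowN1 (_ : - (x + - (1)) = - x + 1); last by ring.
by rewrite tpowD tpow1.
Qed.

Hypothesis tt1 : t - / t <> 0.

(** The scalar part of the Baxterised operator, which includes the [- t^-1] of
    the Hecke generator. *)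
Lemma tbax_coef x : tnum t logt x <> 0 ->
  tpow logt (- x) / tnum t logt x - / t = - (tnum t logt (x - 1) / tnum t logt x).
Proof.
rewrite tnumB1 /tnum => x0.
have Hx : tpow logt x - tpow logt (- x) <> 0.
  by move=> H; apply: x0; rewrite H /Cdiv Cmult_0_l.
have Ht : t * t - 1 <> 0.
  have -> : t * t - 1 = t * (t - / t) by field.
  exact: Cmult_neq_0.
by field.
Qed.

(** The eigenvalue of the Baxterised operator on [Delta_t] times a function
    symmetric in the two exchanged points, where [nabla] acts as [t + t^-1]. *)
Lemma tbax_symm_coef x : tnum t logt x <> 0 ->
  t + / t + - (tnum t logt (x - 1) / tnum t logt x)
  = tnum t logt (x + 1) / tnum t logt x.
Proof.
rewrite tnumB1 tnumD1 /tnum => x0.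
have Hx : tpow logt x - tpow logt (- x) <> 0.
  by move=> H; apply: x0; rewrite H /Cdiv Cmult_0_l.
have Ht : t * t - 1 <> 0.
  have -> : t * t - 1 = t * (t - / t) by field.
  exact: Cmult_neq_0.
by field.
Qed.

(** * Action of the Baxterised operators on residue sums *)

Variable n : nat.
Implicit Types (z : nat -> C) (f : nat -> C -> C).

Definition kernel (w : nat -> C) : C :=
  vdm n (fun i => w (n.+1 - i)%N) * Delta_t t n w.

(** The iterated integral with an arbitrary numerator [f m] in the variable
    [w_(m+1)], up to a power of [2 pi i]. *)
Definition Psi z f : C :=
  iter_res t (2 * n) z n
    (fun w => kernel w * \big[Cmult/RtoC 1]_(0 <= m < n) f m (w m.+1)).

Definition slot f (k : nat) (g : C -> C) : nat -> C -> C :=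
  fun m => if m == k then g else f m.

Lemma slot_prod f k g w : (k < n)%N ->
  \big[Cmult/RtoC 1]_(0 <= m < n) slot f k g m (w m.+1)
  = g (w k.+1) * \big[Cmult/RtoC 1]_(0 <= m < n | m != k) f m (w m.+1).
Proof.
move=> kn; rewrite (bigD1_seq k) ?mem_index_iota ?iota_uniq //= {1}/slot eqxx.
by congr (_ * _); apply: eq_bigr => m mk; rewrite /slot ifN.
Qed.

Lemma Psi_lin z f k g g1 g2 a b : (k < n)%N ->
  (forall x, g x = a * g1 x + b * g2 x) ->
  Psi z (slot f k g) = a * Psi z (slot f k g1) + b * Psi z (slot f k g2).
Proof.
by move=> kn H; apply: iter_res_lin => w; rewrite !slot_prod // H; ring.
Qed.
Arguments Psi_lin {z f k} g g1 g2 a b _ _.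

Lemma Psi_ext z f1 f2 : (forall m x, (m < n)%N -> f1 m x = f2 m x) ->
  Psi z f1 = Psi z f2.
Proof.
move=> H; apply: iter_res_ext => w; congr (_ * _).
by apply: eq_big_nat => m Hm; apply: H; lia.
Qed.

Definition factor (al : nat -> nat) (Y : nat -> C) z : nat -> C -> C :=
  fun m x => wave_num t (2 * n) z (al m) x + Y m * wave_num t (2 * n) z (al m).-1 x.

(** The right-hand side of the integral formula for arbitrary indices [al] and
    coefficients [Y]; partially built diagrams stay within this family. *)
Definition state (al : nat -> nat) (Y : nat -> C) z : C :=
  Delta_t t (2 * n) z * Psi z (factor al Y z).

Definition update (T : Type) (h : nat -> T) (k : nat) (x : T) : nat -> T :=
  fun m => if m == k then x else h m.

(** Besides the wanted terms, the operator produces the numerator of index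
    [al k - 1] in slot [k], with the coefficient [1 + Y_k [x + 1] / [x]].  The
    disjunction lists the two ways in which it disappears: [Y_k] is the
    coefficient that a box with parameter [x + 1] leaves, or the residue sum
    vanishes.  The condition on the other slots says that their factors are
    symmetric in the two exchanged points. *)
Lemma Tbax_state (al : nat -> nat) (Y : nat -> C) (X : (nat -> C) -> C) k x z :
  (k < n)%N -> (1 <= al k)%N -> (al k < 2 * n)%N -> tnum t logt x <> 0 ->
  (forall m, (m < n)%N -> m <> k -> al m <> al k /\ (al m).-1 <> al k) ->
  z (al k) <> z (al k).+1 ->
  tnum t logt (x + 1) * Y k + tnum t logt x = 0 \/
    Psi z (slot (factor al Y z) k (wave_num t (2 * n) z (al k).-1)) = 0 ->
  X z = state al Y z ->
  X (swap (al k) z) = state al Y (swap (al k) z) ->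
  Tbax t logt (al k) x X z
  = state (update al k (al k).+1)
      (update Y k (- (tnum t logt (x - 1) / tnum t logt x))) z.
Proof.
set i := al k => kn i1 i2n x0 Hal zi HY Xz Xs.
set F := factor al Y z.
set q := wave_num t (2 * n) z.
set q' := wave_num t (2 * n) (swap i z) i.
set kap := - (tnum t logt (x - 1) / tnum t logt x).
have Sz : state al Y z = Delta_t t (2 * n) z *
    (Psi z (slot F k (q i)) + Y k * Psi z (slot F k (q i.-1))).
  congr (_ * _); rewrite -[Psi z (slot F k (q i))]Cmult_1_l.
  rewrite -(Psi_lin (F k)) //; last by move=> y; rewrite /F /factor -/i -/q; ring.
  by apply: Psi_ext => m y _; rewrite /slot; case: eqP => [->|].
have Ss : state al Y (swap i z) = Delta_t t (2 * n) (swap i z) *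
    (Psi z (slot F k q') + Y k * Psi z (slot F k (q i.-1))).
  congr (_ * _); rewrite -[Psi z (slot F k q')]Cmult_1_l.
  rewrite -(Psi_lin (fun y => q' y + Y k * q i.-1 y)) //; last by move=> y; ring.
  rewrite /Psi iter_res_swap //; apply: Psi_ext => m y mn.
  rewrite /slot /factor; case: eqP => [->|mk].
    by rewrite -/i (@wave_num_swap t (2 * n) z i i.-1 y) //; lia.
  by have [h1 h2] := Hal m mn mk; rewrite !wave_num_swap.
have Sn : state (update al k i.+1) (update Y k kap) z = Delta_t t (2 * n) z *
    (Psi z (slot F k (q i.+1)) + kap * Psi z (slot F k (q i))).
  congr (_ * _); rewrite -[Psi z (slot F k (q i.+1))]Cmult_1_l.
  rewrite -(Psi_lin (fun y => q i.+1 y + kap * q i y)) //; last by move=> y; ring.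
  by apply: Psi_ext => m y _; rewrite /slot /factor /update; case: eqP.
(* The three-term relation for the numerators, integrated. *)
have E : (t * z i - / t * z i.+1) * Psi z (slot F k (q i))
    + (- (t * z i.+1 - / t * z i)) * Psi z (slot F k q')
  = (z i - z i.+1) * Psi z (slot F k (q i.-1))
    + (z i - z i.+1) * Psi z (slot F k (q i.+1)).
  rewrite -(Psi_lin (fun y => (z i - z i.+1) * (q i.-1 y + q i.+1 y))) //; last first.
    by move=> y; rewrite /q -wave_num_exchange //; rewrite /q'; ring.
  by apply: Psi_lin => // y; ring.
have D := Delta_t_swap t z i1 i2n.
rewrite /Tbax /nabla Xz Xs Sz Ss Sn.
have HY' : (1 + Y k * (t + / t + kap)) * Psi z (slot F k (q i.-1)) = 0.
  case: HY => [HY|->]; last by ring.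
  rewrite /kap tbax_symm_coef //.
  have -> : 1 + Y k * (tnum t logt (x + 1) / tnum t logt x)
    = (tnum t logt (x + 1) * Y k + tnum t logt x) / tnum t logt x by field.
  by rewrite HY /Cdiv !Cmult_0_l.
have Ek : tpow logt (- x) / tnum t logt x = kap + / t.
  by rewrite /kap -tbax_coef //; ring.
rewrite Ek.
move: (Psi z (slot F k (q i))) (Psi z (slot F k q')) (Psi z (slot F k (q i.-1)))
  (Psi z (slot F k (q i.+1))) E HY' => P1 P1' P0 P2 E HY'.
move: D; set A := _ - _; set B := _ - _ => D.
have d0 : z i - z i.+1 <> 0 by exact: Cminus_eq_contra.
set DD := Delta_t t (2 * n) z; set D' := Delta_t t (2 * n) (swap i z).
have AB : A - B = (z i - z i.+1) * (t + / t) by rewrite /A /B; ring.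
have Edd : A / (z i - z i.+1) * (DD * (P1 + Y k * P0) - D' * (P1' + Y k * P0))
    = DD * (P0 + P2 + Y k * (t + / t) * P0).
  transitivity ((DD * A * (P1 + Y k * P0) - A * D' * (P1' + Y k * P0)) / (z i - z i.+1)).
    by field.
  rewrite D.
  transitivity (DD * ((A * P1 + - B * P1') + Y k * P0 * (A - B)) / (z i - z i.+1)).
    by rewrite -/DD; field.
  by rewrite (E : A * P1 + - B * P1' = _) AB; field; split.
rewrite Edd.
transitivity (DD * (P2 + kap * P1) + DD * ((1 + Y k * (t + / t + kap)) * P0)).
  by ring.
by rewrite HY'; ring.
Qed.
End QuantumNumbers.

(** * Residue sums of staircase families *)

Lemma kernel_eq0 t n w i j : (1 <= i < j)%N -> (j <= n)%N -> w i = w j ->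
  kernel t n w = 0.
Proof.
move=> ij jn E; rewrite /kernel /vdm (prod_eq0 (i := (n.+1 - i)%N)) ?Cmult_0_l //.
  by lia.
rewrite (prod_eq0 (i := (n.+1 - j)%N)) //; first by lia.
rewrite (_ : n.+1 - (n.+1 - j) = j)%N; last by lia.
rewrite (_ : n.+1 - (n.+1 - i) = i)%N; last by lia.
by rewrite E; ring.
Qed.

Lemma confined_kernel t n z (f : nat -> C -> C) K : (K <= n)%N ->
  (forall m j, (m < K)%N -> (m.+1 < j <= 2 * n)%N -> f m (z j) = 0) ->
  confined (2 * n) z K
    (fun w => kernel t n w * \big[Cmult/RtoC 1]_(0 <= m < n) f m (w m.+1)).
Proof.
move=> Kn Hf; split=> w i j Hi Hj E.
  by rewrite (kernel_eq0 _ Hi _ E) ?Cmult_0_l //; lia.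
rewrite [X in _ * X](prod_eq0 (i := i.-1)) ?Cmult_0_r //; first by lia.
by rewrite prednK ?E ?Hf //; lia.
Qed.

Lemma factor_eq0 t n z al Y m j : al m = m.+1 -> (m.+1 < j <= 2 * n)%N ->
  factor t n al Y z m (z j) = 0.
Proof.
move=> E Hj; rewrite /factor E !wave_num_eq0; [ring|lia..].
Qed.

(** The first [k] variables are confined to initial segments and the variable
    [w_(k+1)] to [z_1, ..., z_k], so [k + 1] distinct variables share [k] points.
    Formally, collapse puts [w_(k+1)] at [z_(k+1)], a zero of its numerator. *)
Lemma Psi_pigeonhole t n z al Y k : (k < n)%N ->
  (forall m, (m < k)%N -> al m = m.+1) ->
  Psi t n z (slot (factor t n al Y z) k (wave_num t (2 * n) z k)) = 0.
Proof.
move=> kn Hal; apply: (@iter_res_eq0 t (2 * n) z k.+1); [lia|lia|..].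
- apply: confined_kernel => // m j mk Hj; rewrite /slot; case: eqP => mk'.
    by rewrite wave_num_eq0 //; lia.
  by apply: factor_eq0 => //; apply: Hal; lia.
- move=> w E; rewrite slot_prod // E wave_num_eq0; [ring|lia].
Qed.

Lemma prod_inv (F : nat -> C) m n :
  \big[Cmult/RtoC 1]_(m <= i < n) / F i = / (\big[Cmult/RtoC 1]_(m <= i < n) F i).
Proof.
symmetry; apply: (@big_morph _ _ Cinv 1 Cmult 1 Cmult); first exact: Cinv_mult.
by rewrite -[LHS]Cmult_1_l; apply: Cinv_r; exact: C1_nz.
Qed.

Lemma Delta_t_by_rows t N x : Delta_t t N x =
  \big[Cmult/RtoC 1]_(1 <= i < N.+1) \big[Cmult/RtoC 1]_(i.+1 <= j < N.+1)
    (t * x i - / t * x j).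
Proof.
transitivity (\big[Cmult/RtoC 1]_(1 <= j < N.+1)
    \big[Cmult/RtoC 1]_(1 <= i < N.+1 | (i < j)%N) (t * x i - / t * x j)).
  by apply: eq_big_nat => j Hj; rewrite (big_nat_widen _ _ N.+1) //; lia.
rewrite (exchange_big_dep_nat xpredT) //=; apply: eq_big_nat => i Hi.
by rewrite [RHS](big_nat_widenl _ 1) //=.
Qed.

(** Only the first half of the outer product is written out, because its factors
    are cancelled one by one by the residues of the collapsed sum. *)
Lemma Delta_t_split t n x : Delta_t t (n + n) x =
  \big[Cmult/RtoC 1]_(1 <= i < n.+1) \big[Cmult/RtoC 1]_(i.+1 <= j < (n + n).+1)
    (t * x i - / t * x j)
  * Delta_t t n (fun i => x (n + i)%N).
Proof.
rewrite !Delta_t_by_rows (big_cat_nat (n := n.+1)) //=; last by lia.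
congr (_ * _); rewrite -{1}[n.+1]add1n big_addn (_ : (n + n).+1 - n = n.+1)%N; last by lia.
apply: eq_big_nat => i Hi; rewrite -addSn big_addn (_ : (n + n).+1 - n = n.+1)%N; last by lia.
by apply: eq_big_nat => j Hj; rewrite !(addnC n).
Qed.

Lemma vdm_rev n x : vdm n (fun i => x (n.+1 - i)%N) =
  \big[Cmult/RtoC 1]_(1 <= i < n.+1) \big[Cmult/RtoC 1]_(1 <= j < i) (x i - x j).
Proof.
transitivity (\big[Cmult/RtoC 1]_(1 <= j < n.+1)
    \big[Cmult/RtoC 1]_(1 <= i < n.+1 | (i < j)%N) (x (n.+1 - i)%N - x (n.+1 - j)%N)).
  by apply: eq_big_nat => j Hj; rewrite (big_nat_widen _ _ n.+1) //; lia.
rewrite (exchange_big_dep_nat xpredT) //= big_nat_rev /=.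
apply: eq_big_nat => i Hi; rewrite [LHS]big_nat_rev [RHS](big_nat_widen _ _ n.+1) /=; last by lia.
rewrite big_nat_cond [RHS]big_nat_cond; apply: eq_big => j.
  by apply/idP/idP; lia.
by move=> Hj; congr (x _ - x _); lia.
Qed.

(** The second condition, with [i] and [j] distinct or not, keeps the outer poles
    [z_j / t ^ 2] of the wave functions away from the [z_i]. *)
Definition generic_points (t : C) (n : nat) (z : nat -> C) : Prop :=
  (forall i j, (1 <= i <= 2 * n)%N -> (1 <= j <= 2 * n)%N -> i <> j -> z i <> z j) /\
  (forall i j, (1 <= i <= 2 * n)%N -> (1 <= j <= 2 * n)%N -> t * z i - / t * z j <> 0).

Lemma generic_points_swap t n i z : (1 <= i)%N -> (i < 2 * n)%N ->
  generic_points t n z -> generic_points t n (swap i z).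
Proof.
move=> i1 i2n [H1 H2].
have E k : swap i z k = z (if k == i then i.+1 else if k == i.+1 then i else k).
  by rewrite /swap; case: eqP => // _; case: eqP.
split=> j k Hj Hk; rewrite !E; [move=> jk; apply: H1|apply: H2];
  do ?[case: eqP]; lia.
Qed.

(** The residue of the wave function [phi_i] at its pole [z_i], which is the form
    in which the value of a collapsed sum is needed. *)
Lemma wave_residue t n z i : generic_points t n z -> (1 <= i <= 2 * n)%N ->
  residue_wt (2 * n) z (z i) / outer_poles t (2 * n) z (z i) * wave_num t (2 * n) z i (z i)
  = / (\big[Cmult/RtoC 1]_(1 <= j < i) (z i - z j))
    * / (\big[Cmult/RtoC 1]_(i.+1 <= j < (2 * n).+1) (t * z i - / t * z j)).
Proof.
move=> [H1 H2] Hi.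
have i1 : (1 <= i)%N by lia.
have i2 : (i <= (2 * n).+1)%N by lia.
have i3 : (i < (2 * n).+1)%N by lia.
have W : residue_wt (2 * n) z (z i) = / (\big[Cmult/RtoC 1]_(1 <= j < i) (z i - z j)
     * \big[Cmult/RtoC 1]_(i.+1 <= j < (2 * n).+1) (z i - z j)).
  rewrite /residue_wt; congr (/ _); rewrite (big_cat_nat i1 i2) /= (big_ltn i3).
  case: Ceq_dec => [?|[]//] /=; rewrite Cmult_1_l; congr (_ * _);
    apply: eq_big_nat => j Hj; case: Ceq_dec => // E; case: (H1 i j) => //; lia.
rewrite W /outer_poles /wave_num [X in _ / X](big_cat_nat (n := i.+1)) //=.
rewrite !Cinv_mult.
have N1 : \big[Cmult/RtoC 1]_(i.+1 <= j < (2 * n).+1) (z i - z j) <> 0.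
  by apply: prod_neq0 => j Hj; apply: Cminus_eq_contra; apply: H1; lia.
have N2 : \big[Cmult/RtoC 1]_(1 <= m < i.+1) (t * z i - / t * z m) <> 0.
  by apply: prod_neq0 => j Hj; apply: H2; lia.
rewrite /Cdiv Cinv_mult.
set P := / (\big[_/_]_(1 <= j < i) _); set Q := / (\big[_/_]_(i.+1 <= j < _) (_ * _ - _)).
by field; split.
Qed.

(** The starting point, for the empty diagram.  Only the term [w_i = z_i]
    contributes.  There the residues cancel the Vandermonde product and all the
    factors of [Delta_t] in the [2 n] points that involve one of the first [n];
    the kernel supplies those with both points among the first [n], and the last
    [n] points keep theirs.  The numerators of index [m] in slot [m] vanish at
    [z_(m+1)], so the value holds for every [Y]. *)
Lemma state_base t n z al Y : generic_points t n z ->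
  (forall m, (m < n)%N -> al m = m.+1) ->
  state t n al Y z = Delta_t t n z * Delta_t t n (fun i => z (n + i)%N).
Proof.
move=> Hg Hal; rewrite /state /Psi iter_res_collapse; last 1 first.
- by apply: confined_kernel => // m j mn Hj; apply: factor_eq0 => //; exact: Hal.
- have -> : kernel t n (diagonal z n) = vdm n (fun i => z (n.+1 - i)%N) * Delta_t t n z.
    congr (_ * _).
      apply: eq_big_nat => j Hj; apply: eq_big_nat => i Hi.
      by rewrite /diagonal !ifT //; lia.
    apply: eq_big_nat => j Hj; apply: eq_big_nat => i Hi.
    by rewrite /diagonal !ifT //; lia.
  have -> : \big[Cmult/RtoC 1]_(0 <= m < n) factor t n al Y z m (diagonal z n m.+1)
      = \big[Cmult/RtoC 1]_(1 <= i < n.+1) wave_num t (2 * n) z i (z i).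
    rewrite [RHS]big_add1 /=; apply: eq_big_nat => m Hm.
    rewrite /diagonal ifT; last by lia.
    by rewrite /factor Hal //= [wave_num t (2 * n) z m _]wave_num_eq0; [ring|lia].
  rewrite vdm_rev [Delta_t t (2 * n) z](_ : _ = Delta_t t (n + n) z); last first.
    by rewrite mul2n -addnn.
  rewrite Delta_t_split.
  set A := \big[_/_]_(1 <= i < n.+1) \big[_/_]_(i.+1 <= j < _) _.
  set B := \big[_/_]_(1 <= i < n.+1) \big[_/_]_(1 <= j < i) _.
  set R := \big[_/_]_(1 <= i < n.+1) (_ / _).
  set Q := \big[_/_]_(1 <= i < n.+1) wave_num _ _ _ _ _.
  have RQ : R * Q = / B * / A.
    rewrite /R /Q -big_split /= /A /B -!prod_inv -big_split /=.
    apply: eq_big_nat => i Hi; rewrite wave_residue //; last by lia.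
    by rewrite mul2n -addnn.
  case: Hg => H1 H2.
  have A0 : A <> 0.
    apply: prod_neq0 => i Hi; apply: prod_neq0 => j Hj; apply: H2; lia.
  have B0 : B <> 0.
    apply: prod_neq0 => i Hi; apply: prod_neq0 => j Hj.
    apply: Cminus_eq_contra; apply: H1; lia.
  set D2 := Delta_t t n (fun i => _); set D1 := Delta_t t n z.
  transitivity (A * B * D1 * D2 * (R * Q)); first by ring.
  by rewrite RQ; field.
- by lia.
Qed.

(** * Building the diagram box by box *)

Lemma state_ext t n z al al' Y Y' :
  (forall m, (m < n)%N -> al m = al' m /\ Y m = Y' m) ->
  state t n al Y z = state t n al' Y' z.
Proof.
move=> H; congr (_ * _); apply: Psi_ext => m x mn.
by rewrite /factor; have [-> ->] := H m mn.
Qed.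

Lemma iota1S r : iota 1 r.+1 = iota 1 r ++ [:: r.+1].
Proof. by have := iotaD 1 r 1; rewrite addn1. Qed.

Section Diagram.
Variables (t logt : C) (n : nat) (lam : nat -> nat) (u : nat -> C).
Hypothesis t0 : t <> 0.
Hypothesis tt1 : t - / t <> 0.
Hypothesis logtE : Cexp logt = t.
Hypothesis n1 : (1 <= n)%N.
Hypothesis lam0 : lam 0%N = 0%N.
Hypothesis lam_mono : forall k, (1 <= k)%N -> (k.+1 < n)%N -> (lam k <= lam k.+1)%N.
Hypothesis lam_le : forall k, (k < n)%N -> (lam k <= k)%N.
Hypothesis boxes_neq0 :
  forall b : nat * nat, b \in boxes n lam -> tnum t logt (boxpar n u b) <> 0.

Let a k := (lam k + k + 1)%N.
Let y k := - (tnum t logt (u k + NtoC k - NtoC (lam k))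
             / tnum t logt (u k + NtoC k - NtoC (lam k) + 1)).

Lemma NtoCD i j : NtoC (i + j) = NtoC i + NtoC j.
Proof. by rewrite /NtoC plus_INR RtoC_plus. Qed.

Lemma NtoCS i : NtoC i.+1 = NtoC i + 1.
Proof. by rewrite -addn1 NtoCD. Qed.

Lemma lam_mono_lt k m : (1 <= k)%N -> (k < m)%N -> (m < n)%N -> (lam k <= lam m)%N.
Proof.
move=> k1; elim: m => // m IH; rewrite ltnS leq_eqVlt => /orP[/eqP <-|km] mn.
  exact: lam_mono.
by apply: leq_trans (IH km (ltnW mn)) _; apply: lam_mono; lia.
Qed.

Lemma box_param k j : (1 <= k < n)%N ->
  boxpar n u (n - k, j.+1)%N = u k + NtoC k - NtoC j.
Proof.
move=> Hk; rewrite /boxpar /= (_ : n - (n - k) = k)%N; last by lia.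
have -> : NtoC n = NtoC (n - k) + NtoC k by rewrite -NtoCD; congr NtoC; lia.
by rewrite NtoCS; ring.
Qed.

Lemma box_neq0 k j : (1 <= k < n)%N -> (j < lam k)%N ->
  tnum t logt (u k + NtoC k - NtoC j) <> 0.
Proof.
move=> Hk jk; rewrite -box_param //; apply: boxes_neq0.
by apply/allpairsPdep; exists (n - k)%N, j.+1; split=> //;
  rewrite mem_iota; [lia|rewrite (_ : n - (n - k) = k)%N; lia].
Qed.

(** The state after the rows above row [n - k] and the first [j] boxes of that
    row.  Row [n - k] acts on slot [k] only; the slots below [k] still have their
    initial indices, and those above [k] their final ones. *)
Definition row_idx k j m : nat :=
  if (m < k)%N then m.+1 else if m == k then (k + j).+1 else a m.

(** Slots whose row has not started carry the final coefficient already: by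
    [state_base] and [Psi_pigeonhole] it then multiplies a vanishing sum. *)
Definition row_coef k j m : C :=
  if (m == k) && (0 < j)%N then
    - (tnum t logt (u k + NtoC k - NtoC j) / tnum t logt (u k + NtoC k - NtoC j + 1))
  else y m.

Definition apply_box (f : (nat -> C) -> C) (b : nat * nat) : (nat -> C) -> C :=
  Tbax t logt (n + b.2 - b.1)%N (boxpar n u b) f.

(** The operators divide by differences of coordinates, so the identities hold
    at generic points only; exchanges of coordinates preserve genericity, which is
    enough to iterate. *)
Definition agrees (X : (nat -> C) -> C) (al : nat -> nat) (Y : nat -> C) : Prop :=
  forall z, generic_points t n z -> X z = state t n al Y z.

(** Box [j + 1] of row [n - k] has the parameter [u_k + k - j], one less than its
    left neighbour, and exchanges the points [k + j + 1] and [k + j + 2].  The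
    other slots do not notice: those below [k] have indices at most [k], and those
    above [k] have reached [lam m + m + 1], which exceeds [lam k + k + 1] because
    the diagram is a partition. *)
Lemma row_agrees k j X : (1 <= k < n)%N -> (j <= lam k)%N ->
  agrees X (row_idx k 0) (row_coef k 0) ->
  agrees (foldl apply_box X [seq ((n - k)%N, i) | i <- iota 1 j])
    (row_idx k j) (row_coef k j).
Proof.
move=> Hk; elim: j => [//|j IH] jl HX.
have {}IH := IH (ltnW jl) HX.
rewrite iota1S map_cat foldl_cat /=.
move: (foldl _ _ _) IH => {HX}X HX z Hz.
have lk := lam_le (proj2 (andP Hk)).
have ik : row_idx k j k = (k + j).+1 by rewrite /row_idx ltnn eqxx.
rewrite /apply_box box_param // (_ : n + (n - k, j.+1).2 - (n - k, j.+1).1 = row_idx k j k)%N;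
  last by rewrite ik /=; lia.
set x := u k + NtoC k - NtoC j.
have i2n : (row_idx k j k < 2 * n)%N by rewrite ik; lia.
have i1 : (1 <= row_idx k j k)%N by rewrite ik.
rewrite (Tbax_state (al := row_idx k j) (Y := row_coef k j) (n := n) t0 logtE tt1) //.
- apply: state_ext => m mn; split.
    rewrite /update ik /row_idx; case: eqP => [->|//].
    by rewrite ltnn addnS.
  rewrite /update /row_coef; case: eqP => [->|//] /=.
  rewrite NtoCS (_ : u k + NtoC k - (NtoC j + 1) = x - 1); last by rewrite /x; ring.
  by rewrite (_ : x - 1 + 1 = x) //; ring.
- by lia.
- exact: box_neq0.
- move=> m mn mk; rewrite ik /row_idx; case: ltnP => mk'; first by lia.
  rewrite ifN; last by apply/eqP.
  (* Both al m and al m - 1 have to avoid k + j + 1, and j < lam k <= lam m. *)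
  have := @lam_mono_lt k m (proj1 (andP Hk)).
  by rewrite /a; lia.
- by case: Hz => H1 _; apply: H1; lia.
- have [j0|j0] := posnP j.
    right; rewrite ik j0 addn0 /=; apply: Psi_pigeonhole; first by lia.
    by move=> m mk; rewrite /row_idx mk.
  left; rewrite /row_coef eqxx j0 /= -/x.
  have : tnum t logt (x + 1) <> 0.
    have -> : x + 1 = u k + NtoC k - NtoC j.-1.
      by rewrite /x -[in NtoC j](prednK j0) NtoCS; ring.
    by apply: box_neq0 => //; lia.
  by move=> H; field.
- exact: HX.
- by apply: HX; apply: generic_points_swap.
Qed.

Lemma Mac_agrees : agrees (Mac t logt n lam u) a y.
Proof.
suff H r : (r <= n.-1)%N ->
    agrees (foldl apply_box
        (fun z => Delta_t t n z * Delta_t t n (fun i => z (n + i)%N))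
        [seq (i, j) | i <- iota 1 r, j <- iota 1 (lam (n - i))])
      (row_idx (n.-1 - r) 0) y.
  move=> z Hz; rewrite /Mac /boxes -/apply_box (H n.-1 (leqnn _) z Hz).
  apply: state_ext => m mn; split => //.
  by rewrite subnn /row_idx; case: m mn => //= _; rewrite /a lam0.
elim: r => [|r IH] rn.
  move=> z Hz /=; rewrite state_base // => m mn.
  rewrite /row_idx; case: ltnP => // ?; case: eqP => [->|]; first by rewrite addn0.
  by lia.
rewrite iota1S map_cat flatten_cat foldl_cat /= cats0.
have {}IH := IH (ltnW rn).
move: (foldl _ _ _) IH => X HX.
set k := (n.-1 - r)%N in HX *.
have Hk : (1 <= k < n)%N by rewrite /k; lia.
have -> : r.+1 = (n - k)%N by rewrite /k; lia.
rewrite (_ : n - (n - k) = k)%N; last by lia.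
have HR := @row_agrees k (lam k) X Hk (leqnn _).
move=> z Hz; rewrite HR //; last first.
  move=> z' Hz'; rewrite HX //; apply: state_ext => m mn; split => //.
  by rewrite /row_coef andbF.
apply: state_ext => m mn; split.
  rewrite /row_idx; case: (ltngtP m k) => mk; [|by rewrite ifN ?ifN //; lia|].
    case: ltnP => // mk'; rewrite ifT //; lia.
  by rewrite mk ifN ?ifN /a; lia.
rewrite /row_coef; case: eqP => [->|//] /=.
by case: ifP.
Qed.

End Diagram.

(** * Wave functions *)

Definition common_den t N z w : C := inner_poles N z w * outer_poles t N z w.

Lemma phi_wave_num t n z i w : (i <= 2 * n)%N ->
  (forall m, (1 <= m <= 2 * n)%N -> w - z m <> 0 /\ t * w - / t * z m <> 0) ->
  phi t n z i w = wave_num t (2 * n) z i w / common_den t (2 * n) z w.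
Proof.
move=> i2n H; rewrite /phi /wave_num /common_den /inner_poles /outer_poles.
rewrite [X in _ / (X * _)](big_cat_nat (n := i.+1)) //=.
rewrite [X in _ / (_ * X)](big_cat_nat (n := i.+1)) //= !prod_inv.
have N1 : \big[Cmult/RtoC 1]_(1 <= m < i.+1) (t * w - / t * z m) <> 0.
  by apply: prod_neq0 => m Hm; case: (H m) => //; lia.
have N2 : \big[Cmult/RtoC 1]_(i.+1 <= m < (2 * n).+1) (w - z m) <> 0.
  by apply: prod_neq0 => m Hm; case: (H m) => //; lia.
rewrite /Cdiv !Cinv_mult.
set P := / (\big[_/_]_(1 <= m < i.+1) (w - _)).
set Q := / (\big[_/_]_(i.+1 <= m < _) (_ * _ - _)).
by field; split.
Qed.

Lemma phi_pred t n z i w : (1 <= i <= 2 * n)%N -> w - z i <> 0 ->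
  phi t n z i.-1 w = (w - z i) / (t * w - / t * z i) * phi t n z i w.
Proof.
case: i => // i Hi w0; rewrite /phi /= (big_nat_recr i.+1) //=.
rewrite (big_ltn (m := i.+1)); last by lia.
by rewrite /Cdiv; move: (/ (t * w - / t * z i.+1)) => c; field.
Qed.

(** The two terms differ by the factor [(w - z_i) / (t w - z_i / t)], so this
    reduces to
    [[v + 1] (t w - z_i / t) - [v] (w - z_i) = t^(v+1) w - t^(-v-1) z_i]. *)
Lemma one_plus_yS_closed (t logt : C) n z v i w : t <> 0 -> t - / t <> 0 ->
  Cexp logt = t -> (1 <= i <= 2 * n)%N -> w - z i <> 0 -> t * w - / t * z i <> 0 ->
  tnum t logt (v + 1) <> 0 ->
  one_plus_yS t n z (- (tnum t logt v / tnum t logt (v + 1))) i i w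
  = / tnum t logt (v + 1)
    * ((tpow logt (v + 1) * w - tpow logt (- v - 1) * z i) / (t * w - / t * z i))
    * phi t n z i w.
Proof.
move=> t0 tt1 E Hi w1 w2 v0.
rewrite /one_plus_yS /Sidx eqxx phi_pred //; move: (phi _ _ _ _ _) => p.
have -> : - v - 1 = - v + - (1) by ring.
have Ht : t * t - 1 <> 0.
  have -> : t * t - 1 = t * (t - / t) by field.
  exact: Cmult_neq_0.
have Hw : t * w * t - z i <> 0.
  have -> : t * w * t - z i = t * (t * w - / t * z i) by field.
  exact: Cmult_neq_0.
move: v0; rewrite !(tnumD1 t0 E) !tpowD (tpow1 E) (tpowN1 t0 E) /tnum => v0.
have Hv : tpow logt v * t * t - tpow logt (- v) <> 0.
  move=> H; apply: v0.
  have -> : tpow logt v * t - tpow logt (- v) * / t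
     = (tpow logt v * t * t - tpow logt (- v)) * / t by field.
  by rewrite H /Cdiv !Cmult_0_l.
by field; repeat split.
Qed.

(** * The integral formula *)

Lemma polyfun_coord w m i : polyfun (fun x => upd w m x i).
Proof.
rewrite /upd; case: (i == m); [exact: polyfun_id|exact: polyfun_const].
Qed.

Lemma polyfun_affine a b f : polyfun f -> polyfun (fun x => a * f x - b).
Proof.
move=> Hf; apply: polyfun_plus; first exact: polyfun_scal.
exact: polyfun_const.
Qed.

Lemma polyfun_affine2 a b f g : polyfun f -> polyfun g ->
  polyfun (fun x => a * f x - b * g x).
Proof.
move=> Hf Hg; apply: (polyfun_ext (f := fun x => a * f x + (- b) * g x)).
  by move=> x; ring.
by apply: polyfun_plus; exact: polyfun_scal.
Qed.

Lemma separately_poly_kernel t n c (al : nat -> nat) (Y : nat -> C) z :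
  separately_poly (fun w => c * (kernel t n w *
     \big[Cmult/RtoC 1]_(0 <= m < n) factor t n al Y z m (w m.+1))).
Proof.
move=> m w; apply/polyfun_scal/polyfun_mult; first apply: polyfun_mult.
- do 2![apply: polyfun_prod => ?].
  apply: (polyfun_ext (f := fun x => 1 * upd w m x _ - 1 * upd w m x _)).
    by move=> x; rewrite !Cmult_1_l.
  by apply: polyfun_affine2; exact: polyfun_coord.
- by do 2![apply: polyfun_prod => ?]; apply: polyfun_affine2; exact: polyfun_coord.
- have H k i : polyfun (fun x => wave_num t (2 * n) z k (upd w m x i)).
    apply: polyfun_mult; apply: polyfun_prod => j.
      by apply: polyfun_affine; exact: polyfun_coord.
    apply: (polyfun_ext (f := fun x => 1 * upd w m x i - z j)).
      by move=> x; rewrite Cmult_1_l.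
    by apply: polyfun_affine; exact: polyfun_coord.
  apply: polyfun_prod => i; apply: polyfun_plus => //.
  by apply: polyfun_scal.
Qed.

Theorem theorem1 (t logt : C) (n : nat) (lam : nat -> nat) (u z : nat -> C)
    (gam : nat -> R -> C)
    (t_neq0 : t <> 0)
    (t_not_root : forall k : nat, (0 < k)%N -> Cpow t k <> 1)
    (logtE : Cexp logt = t)
    (n_ge1 : (1 <= n)%N)
    (lam0 : lam 0%N = 0%N)
    (u0 : u 0%N = 0)
    (lam_mono : forall k : nat, (1 <= k)%N -> (k.+1 < n)%N ->
       (lam k <= lam k.+1)%N)
    (lam_le : forall k : nat, (k < n)%N -> (lam k <= k)%N) :
  let a := fun k : nat => (lam k + k + 1)%N in
  let v := fun k : nat => u k + NtoC k - NtoC (lam k) in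
  let y := fun k : nat => - (tnum t logt (v k) / tnum t logt (v k + 1)) in
  forall
    (generic_boxes : forall b : nat * nat, b \in boxes n lam ->
       tnum t logt (boxpar n u b) <> 0)
    (generic_v : forall k : nat, (k < n)%N -> tnum t logt (v k + 1) <> 0)
    (generic_z : forall i j : nat, (1 <= i < j)%N -> (j <= 2 * n)%N ->
       z i <> z j)
    (gam_contour : forall m : nat, (1 <= m <= n)%N -> contour (gam m))
    (gam_in : forall m i : nat, (1 <= m <= n)%N -> (1 <= i <= 2 * n)%N ->
       encircles_once (gam m) (z i))
    (gam_out : forall m i : nat, (1 <= m <= n)%N -> (1 <= i <= 2 * n)%N ->
       leaves_outside (gam m) (/ (t * t) * z i)),
  Mac t logt n lam u z
  = Delta_t t (2 * n) z *
    iter_cint n gam (fun w =>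
      / Cpow (RtoC (2 * PI) * Ci) n
      * vdm n (fun i => w (n.+1 - i)%N) * Delta_t t n w
      * \big[Cmult/RtoC 1]_(0 <= m < n)
          one_plus_yS t n z (y m) (a m) (a m) (w m.+1))
  /\
  Delta_t t (2 * n) z *
    iter_cint n gam (fun w =>
      / Cpow (RtoC (2 * PI) * Ci) n
      * vdm n (fun i => w (n.+1 - i)%N) * Delta_t t n w
      * \big[Cmult/RtoC 1]_(0 <= m < n)
          one_plus_yS t n z (y m) (a m) (a m) (w m.+1))
  = Delta_t t (2 * n) z *
    iter_cint n gam (fun w =>
      / Cpow (RtoC (2 * PI) * Ci) n
      * vdm n (fun i => w (n.+1 - i)%N) * Delta_t t n w
      * \big[Cmult/RtoC 1]_(0 <= m < n)
          (/ tnum t logt (v m + 1)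
           * ((tpow logt (v m + 1) * w m.+1
               - tpow logt (- v m - 1) * z (a m))
              / (t * w m.+1 - / t * z (a m)))
           * phi t n z (a m) (w m.+1))).
Proof.
move=> a v y generic_boxes generic_v generic_z gam_contour gam_in gam_out.
have tt_neq0 : t * t <> 0 by exact: Cmult_neq_0.
have tt1 : t - / t <> 0.
  move=> H; apply: (t_not_root 2%N) => //=.
  have -> : t * (t * 1) = t * (t - / t) + 1 by field.
  by rewrite H; ring.
have z_neq i j : (1 <= i <= 2 * n)%N -> (1 <= j <= 2 * n)%N -> i <> j -> z i <> z j.
  move=> Hi Hj; case: (ltngtP i j) => // ij _.
    by apply: generic_z; lia.
  by move=> /esym; apply: generic_z; lia.
have Hgen : generic_points t n z.
  split=> // i j Hi Hj H.
  have H1n : (1 <= 1 <= n)%N by lia.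
  have [_] := gam_in 1%N i H1n Hi; have [_] := gam_out 1%N j H1n Hj.
  have -> : z i = / (t * t) * z j + / t * (t * z i - / t * z j) by field.
  rewrite H Cmult_0_r Cplus_0_r => -> /RtoC_inj; lra.
have a_le m : (m < n)%N -> (1 <= a m <= 2 * n)%N.
  by move=> mn; have := lam_le m mn; rewrite /a; lia.
have curve_neq m i w : (1 <= m <= n)%N -> (1 <= i <= 2 * n)%N ->
    on_curve (gam m) w -> w - z i <> 0 /\ t * w - / t * z i <> 0.
  move=> Hm Hi [s Hs ->]; split.
    by apply: Cminus_eq_contra; have [H _] := gam_in m i Hm Hi; exact: H.
  have -> : t * gam m s - / t * z i = t * (gam m s - / (t * t) * z i) by field.
  apply: Cmult_neq_0 => //; apply: Cminus_eq_contra.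
  by have [H _] := gam_out m i Hm Hi; exact: H.
pose c := / Cpow (RtoC (2 * PI) * Ci) n.
pose G w := c * (kernel t n w *
   \big[Cmult/RtoC 1]_(0 <= m < n) factor t n a y z m (w m.+1)).
pose pre w := c * vdm n (fun i => w (n.+1 - i)%N) * Delta_t t n w.
have HG w : (forall m, (1 <= m <= n)%N -> on_curve (gam m) (w m)) ->
   pre w * \big[Cmult/RtoC 1]_(0 <= m < n) one_plus_yS t n z (y m) (a m) (a m) (w m.+1)
   = G w / \big[Cmult/RtoC 1]_(1 <= m < n.+1) common_den t (2 * n) z (w m).
  move=> Hw; rewrite /G /pre /kernel /Cdiv -prod_inv big_add1 /=.
  rewrite -!Cmult_assoc -big_split /=; congr (_ * (_ * (_ * _))).
  apply: eq_big_nat => m Hm.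
  have Hc i : (1 <= i <= 2 * n)%N -> _ := fun Hi =>
    curve_neq m.+1 i (w m.+1) (ltac:(lia)) Hi (Hw m.+1 ltac:(lia)).
  have := a_le m ltac:(lia) => Ha.
  rewrite /one_plus_yS /Sidx eqxx !phi_wave_num //; [|lia|lia].
  by rewrite /factor /Cdiv; ring.
have HI F : (forall w, (forall m, (1 <= m <= n)%N -> on_curve (gam m) (w m)) ->
      F w = G w / \big[Cmult/RtoC 1]_(1 <= m < n.+1) common_den t (2 * n) z (w m)) ->
    iter_cint n gam F = Psi t n z (factor t n a y z).
  move=> HF; have N0 : (0 < 2 * n)%N by lia.
  rewrite (iter_cint_residues t_neq0 N0 generic_z gam_contour gam_in gam_out
    (separately_poly_kernel _ _ _ _ _ _) HF).
  rewrite (iter_res_scal c (fun w => kernel t n w *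
    \big[Cmult/RtoC 1]_(0 <= m < n) factor t n a y z m (w m.+1))) //.
  rewrite Cmult_assoc /c -/twopii Cinv_r ?Cmult_1_l //.
  exact/Cpow_nz/twopii_neq0.
rewrite -/c.
have E1 : iter_cint n gam (fun w => pre w *
    \big[Cmult/RtoC 1]_(0 <= m < n) one_plus_yS t n z (y m) (a m) (a m) (w m.+1))
    = Psi t n z (factor t n a y z) by exact: HI.
rewrite /pre in E1; rewrite E1; split.
  by rewrite (Mac_agrees t_neq0 tt1 logtE n_ge1 lam0 lam_mono lam_le generic_boxes Hgen).
congr (_ * _); symmetry; apply: HI => w Hw; rewrite -HG //.
congr (_ * _); apply: eq_big_nat => m Hm.
have [w1 w2] := curve_neq m.+1 (a m) (w m.+1) ltac:(lia) (a_le m ltac:(lia)) (Hw m.+1 ltac:(lia)).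
rewrite /y one_plus_yS_closed //; [exact: a_le|exact: generic_v].
Qed.
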